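(* Let $N\in\mathbb{N}$. For $0\le k\le N$, the map $U_k^{(N)}\colon V_k^{(N)}\to\hat V_k^{(N)}$ is invertible. For $1\le k\le N$, \[ U_k^{(N)}M_{k-1}^{(N)}=\hat M_{k-1}U_{k-1}^{(N)},\qquad \hat D_kU_k^{(N)}=U_{k-1}^{(N)}D_k . \]
   Context: Infinite-color setting. Let $\bm x=(x_1,x_2,\dots)$, let $e_j$ be the elementary symmetric functions in $\bm x$ ($e_0=1$), and let $I_k$ be the set of $k$-tuples of distinct positive integers. $V_k$ is the $\mathbb{Q}(e_1,e_2,\dots)$-vector space with basis $\{b_\sigma:\sigma\in I_k\}$. For $\sigma\in I_k$ set \[ A(1\mid\sigma)=\prod_r\frac{\sigma_r-1}{\sigma_r},\qquad A(\sigma_r+1\mid\sigma)=\frac{\sigma_r+1}{\sigma_r}\prod_{r'\ne r}\frac{\sigma_r-\sigma_{r'}+1}{\sigma_r-\sigma_{r'}}, \] and $A(y\mid\sigma)=0$ for all other positive integers $y$. Let $M_kb_\sigma=\sum_{y\notin\sigma}A(y\mid\sigma)b_{\sigma,y}$ and $D_kb_\sigma=\frac{e_{\sigma_1}}{e_{\sigma_1-1}}b_{\sigma_2,\dots,\sigma_k}$ ($b_{\sigma,y}$ is indexed by $\sigma$ with $y$ appended). $\hat V_k$ is the space of infinite formal sums $\sum_{i\in I_k}F(x_{i_1},\dots,x_{i_k})\hat b_i$ with $F\in x_1\cdots x_k\,\mathbb{Q}(e_1,e_2,\dots)[x_1,\dots,x_k]$ (polynomials in $k$ indeterminates over $\mathbb{Q}(e_1,e_2,\dots)$),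 and $\hat M_k\hat b_i=\sum_{c\notin i}x_c\hat b_{i,c}$, $\hat D_k\hat b_i=\hat b_{i_2,\dots,i_k}$, extended termwise to infinite sums (with $\sum_{c\ge 1} x_c^m=p_m\in\mathbb{Q}[e_1,e_2,\dots]$ for $m\ge1$). The maps $U_k$. $(U_k)_{k\ge0}$ is the family of $\mathbb{Q}(e_1,e_2,\dots)$-linear maps $U_k\colon V_k\to\hat V_k$ with $U_0b_\emptyset=\hat b_\emptyset$, $U_kM_{k-1}=\hat M_{k-1}U_{k-1}$ and $\hat D_kU_k=U_{k-1}D_k$ for all $k\ge1$; such a family exists and these conditions determine it. For $\sigma\in I_k$ one has $U_kb_\sigma=\sum_iF_\sigma(x_{i_1},\dots,x_{i_k})\hat b_i$ where $F_\sigma$ is divisible by $x_1\cdots x_k$ and the coefficient $F_\sigma(x_{i_1},\dots,x_{i_k})$ lies in $x_{i_1}\cdots x_{i_k}\mathbb{Q}[\bm x][e_j^{-1}:j<\max\sigma]$ (here $\mathbb{Q}[\bm x]$ includes symmetric functions in $\bm x$). Finite-color setting. Fix $N\in\mathbb{N}$, work over $\mathbb{Q}(x_1,\dots,x_N)$, and let $I_k^{(N)}$ be the set of $k$-tuples of distinct elements of $[N]=\{1,\dots,N\}$. $V_k^{(N)}$ and $\hat V_k^{(N)}$ are the $\mathbb{Q}(x_1,\dots,x_N)$-vector spaces with bases $\{b_\sigma\}$ and $\{\hat b_i\}$ indexed by $I_k^{(N)}$. (The paper writes simply $I_k,V_k,\hat V_k$ for these.) On these spaces, $M_k^{(N)}b_\sigma=\sum_{y\in[N]\setminus\sigma}A(y\mid\sigma)b_{\sigma,y}$,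 $D_kb_\sigma=\frac{e_{\sigma_1}}{e_{\sigma_1-1}}b_{\sigma_2,\dots,\sigma_k}$ with $e_j=e_j(x_1,\dots,x_N)$, $\hat M_k\hat b_i=\sum_{c\in[N]\setminus i}x_c\hat b_{i,c}$, and $\hat D_k\hat b_i=\hat b_{i_2,\dots,i_k}$. The map $U_k^{(N)}\colon V_k^{(N)}\to\hat V_k^{(N)}$ is obtained from $U_k$ by setting $x_c=0$ for all $c>N$ in the coefficients of $U_kb_\sigma$, $\sigma\in I_k^{(N)}$ (so $e_j$ becomes $e_j(x_1,\dots,x_N)$; no $e_j$ with $j>N$ occurs in a denominator, and terms $\hat b_i$ with some $i_r>N$ vanish), and extending linearly. *)

(* Defs.v *)
From HB Require Import structures.
From Stdlib Require Import ClassicalEpsilon.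
From mathcomp Require Import all_boot all_algebra finmap.
From mathcomp.multinomials Require Import monalg mpoly.

Set Implicit Arguments.
Unset Strict Implicit.
Unset Printing Implicit Defensive.

Import GRing.Theory.
Local Open Scope ring_scope.

(* Both monalg and mpoly define this notation; here it always means mpoly. *)
Notation "{ 'mpoly' R [ n ] }" := (mpoly.mpoly n R) : type_scope.

(** * The field Q(e_1, e_2, ...) *)

(* Q[e_1, e_2, ...], the polynomial ring in countably many indeterminates:
   the indeterminate of index j : nat is e_(j+1). *)
Definition Qe : Type := {malg rat[{cmonom nat}]}.
HB.instance Definition _ := GRing.ComNzRing.on Qe.

Section QeDomain.
Variable n : nat.

Definition Qe_trunc_mon (m : {cmonom nat}) : {mpoly rat[n]} :=
  'X_[[multinom m i | i < n]].

Fact Qe_trunc_mon_morph : mmorphism Qe_trunc_mon.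
Proof.
split=> [m1 m2|]; rewrite /Qe_trunc_mon.
  rewrite -mpolyXD; congr 'X_[_]; apply/mnmP=> i.
  by rewrite mnmDE !mnmE cmM.
rewrite -[RHS]mpolyX0; congr 'X_[_]; apply/mnmP=> i.
by rewrite mnm0E mnmE cm1.
Qed.

HB.instance Definition _ :=
  isMultiplicative.Build {cmonom nat} {mpoly rat[n]} Qe_trunc_mon
    Qe_trunc_mon_morph.

Definition Qe_trunc : {rmorphism {malg rat[{cmonom nat}]} -> {mpoly rat[n]}} :=
  monalg.mmap (@mpolyC n rat) Qe_trunc_mon.

End QeDomain.

Fact Qe_trunc_inj n (p : {malg rat[{cmonom nat}]}) :
  (forall m, m \in monalg.msupp p -> forall i, i \in finsupp m -> (i < n)%N) ->
  Qe_trunc n p = 0 -> p = 0.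
Proof.
move=> bnd p0; apply/malgP=> m; rewrite monalg.mcoeff0.
have [mp|/mcoeff_outdom //] := boolP (m \in monalg.msupp p).
have := congr1 (mpoly.mcoeff [multinom m i | i < n]) p0.
rewrite mpoly.mcoeff0 /Qe_trunc /= monalg.mmapE raddf_sum /= (big_fsetD1 m) //=.
rewrite mpoly.mcoeffCM mcoeffX eqxx mulr1 big_seq big1 ?addr0 // => k.
rewrite in_fsetD1 => /andP[km kp]; rewrite mpoly.mcoeffCM mcoeffX.
case: eqP => [/mnmP E|]; last by rewrite mulr0.
case/eqP: km; apply/eqP/cmP => i.
have [lt_in|le_ni] := ltnP i n.
  by have := E (Ordinal lt_in); rewrite !mnmE.
have out q : q \in monalg.msupp p -> q i = 0%N.
  move=> qp; apply/eqP; rewrite cmE_eq0; apply/negP => /(bnd _ qp).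
  by rewrite ltnNge le_ni.
by rewrite !out.
Qed.

Fact Qe_bound (p : {malg rat[{cmonom nat}]}) : exists n, forall n', (n <= n')%N ->
  forall m, m \in monalg.msupp p -> forall i, i \in finsupp m -> (i < n')%N.
Proof.
exists (\sum_(m <- monalg.msupp p) \sum_(i <- finsupp m) i.+1)%N => n' le m mp i im.
apply: leq_trans le; rewrite (big_fsetD1 m) //= (big_fsetD1 i) //=.
by rewrite -addnA leq_addr.
Qed.

Fact Qe_integral : GRing.integral_domain_axiom Qe.
Proof.
move=> p q pq0; have [np hp] := Qe_bound p; have [nq hq] := Qe_bound q.
have := congr1 (Qe_trunc (maxn np nq)) pq0.
rewrite rmorphM rmorph0 => /eqP; rewrite mulf_eq0 => /orP[] /eqP h.
  by apply/orP; left; apply/eqP; apply: Qe_trunc_inj h; apply: hp; rewrite leq_maxl.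
by apply/orP; right; apply/eqP; apply: Qe_trunc_inj h; apply: hq; rewrite leq_maxr.
Qed.

Definition Qe_unit : pred Qe :=
  fun x => if excluded_middle_informative (exists y, y * x = 1) then true else false.

Definition Qe_inv (x : Qe) : Qe :=
  match excluded_middle_informative (exists y, y * x = 1) with
  | left h => proj1_sig (constructive_indefinite_description _ h)
  | right _ => x
  end.

Fact Qe_mulVx : {in Qe_unit, left_inverse 1 Qe_inv *%R}.
Proof.
move=> x; rewrite unfold_in /Qe_unit /Qe_inv.
by case: excluded_middle_informative => // h _; case: constructive_indefinite_description.
Qed.

Fact Qe_unitP (x y : Qe) : y * x = 1 -> Qe_unit x.
Proof.
move=> yx; rewrite /Qe_unit; case: excluded_middle_informative => // h.
by case: h; exists y.
Qed.

Fact Qe_inv_out : {in [predC Qe_unit], Qe_inv =1 id}.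
Proof.
move=> x; rewrite inE unfold_in /Qe_unit /Qe_inv.
by case: excluded_middle_informative.
Qed.

HB.instance Definition _ :=
  GRing.ComNzRing_hasMulInverse.Build Qe Qe_mulVx Qe_unitP Qe_inv_out.
HB.instance Definition _ := GRing.ComUnitRing_isIntegral.Build Qe Qe_integral.

Definition K : fieldType := {fraction Qe}.

(* e_j, with e_0 = 1; locked so that unification does not evaluate it. *)
HB.lock Definition eQ (j : nat) : Qe := if j is j'.+1 then << ucm j' >> else 1.
Definition e (j : nat) : K := tofrac (eQ j).

(* [:: p_1; ...; p_n], the power sums of x_1, x_2, ... as elements of
   Q[e_1, e_2, ...], by Newton's identities (see psumS). *)
Fixpoint psums (n : nat) : seq K :=
  if n is m.+1 then
    rcons (psums m) ((-1) ^+ m * m.+1%:R * e m.+1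
                     + \sum_(i < m) (-1) ^+ i * e i.+1 * (psums m)`_(m - i.+1))
  else [::].

(* p_m; only meaningful for m >= 1. *)
Definition psum (m : nat) : K := (psums m)`_m.-1.

Fact size_psums n : size (psums n) = n.
Proof. by elim: n => //= n IHn; rewrite size_rcons IHn. Qed.

Fact nth_psums n i : (i < n)%N -> (psums n)`_i = psum i.+1.
Proof.
elim: n => // n IHn; rewrite ltnS leq_eqVlt => /orP[/eqP-> //|lt_in] /=.
by rewrite nth_rcons size_psums lt_in IHn.
Qed.

Fact psumS m : psum m.+1 = (-1) ^+ m * m.+1%:R * e m.+1
  + \sum_(i < m) (-1) ^+ i * e i.+1 * psum (m - i).
Proof.
rewrite /psum /= nth_rcons size_psums ltnn eqxx; congr (_ + _).
apply: eq_bigr => i _; rewrite -[in RHS]subnSK // nth_psums //.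
by rewrite ltn_subrL; case: m i => // -[].
Qed.

(** * Free vector spaces and linear extension *)

Section Lext.
Variables (R : comNzRingType) (I : choiceType) (W : lmodType R) (f : I -> W).

Definition lext (v : {malg R[I]}) : W :=
  \sum_(s <- monalg.msupp v) monalg.mcoeff s v *: f s.

Fact lextEw (d : {fset I}) v : (monalg.msupp v `<=` d)%fset ->
  lext v = \sum_(s <- d) monalg.mcoeff s v *: f s.
Proof.
move=> le; rewrite /lext (big_fset_incl _ le) // => x _ /mcoeff_outdom ->.
by rewrite scale0r.
Qed.

Fact lext_is_linear : linear lext.
Proof.
move=> a u v.
pose d := (monalg.msupp (a *: u + v) `|` (monalg.msupp u `|` monalg.msupp v))%fset.
have hd : (monalg.msupp (a *: u + v) `<=` d)%fset by rewrite fsubsetUl.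
have hu : (monalg.msupp u `<=` d)%fset.
  by rewrite (fsubset_trans (fsubsetUl _ _) (fsubsetUr _ _)).
have hv : (monalg.msupp v `<=` d)%fset.
  by rewrite (fsubset_trans (fsubsetUr _ _) (fsubsetUr _ _)).
rewrite (lextEw hd) (lextEw hu) (lextEw hv).
rewrite scaler_sumr -big_split /=; apply: eq_bigr => s _.
by rewrite monalg.mcoeffD monalg.mcoeffZ scalerDl scalerA.
Qed.

HB.instance Definition _ :=
  GRing.isLinear.Build R {malg R[I]} W *:%R lext lext_is_linear.
End Lext.

(* The basis vector indexed by t; it is 0 if t does not satisfy P. *)
Definition bvec (R : comNzRingType) (T : choiceType) (P : pred T) (t : T) :
    {malg R[{x : T | P x}]} :=
  if insub t is Some u then << u >> else 0.

(* A(y | s) for a sequence s of distinct positive integers. *)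
Definition A (F : fieldType) (y : nat) (s : seq nat) : F :=
  if y == 1%N then \prod_(z <- s) ((z%:R - 1) / z%:R)
  else let w := y.-1 in
    if w \in s then
      (w%:R + 1) / w%:R *
        \prod_(z <- s | z != w) ((w%:R - z%:R + 1) / (w%:R - z%:R))
    else 0.

(** * Infinitely many colors *)

Definition Ik_pred (k : nat) : pred (k.-tuple nat) :=
  fun t => uniq t && (0%N \notin t).
Definition Ik (k : nat) : choiceType := {t : k.-tuple nat | Ik_pred t}.

Definition V (k : nat) : lmodType K := {malg K[Ik k]}.
Definition b (k : nat) (t : k.-tuple nat) : V k := bvec K (@Ik_pred k) t.

(* A(y | s) vanishes unless y is 1 or s_r + 1 for some r, so the sum over all
   y not in s reduces to these values. *)
Definition M (k : nat) : {linear V k -> V k.+1} :=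
  lext (fun s : Ik k =>
    \sum_(y <- 1%N :: [seq z.+1 | z <- val s] | y \notin val s)
      A K y (val s) *: b [tuple of rcons (val s) y]).

Definition D (k : nat) : {linear V k.+1 -> V k} :=
  lext (fun s : Ik k.+1 =>
    (e (thead (val s)) / e (thead (val s)).-1) *: b [tuple of behead (val s)]).

(* The formal sum \sum_i F(x_{i_1}, ..., x_{i_k}) \hat b_i is represented by F,
   an element of x_1 ... x_k K[x_1, ..., x_k]; the r-th indeterminate of F
   stands for x_{i_r}. As x_1, x_2, ... are algebraically independent over K,
   F is determined by the formal sum. *)
Definition hatV (k : nat) (F : {mpoly K[k]}) : Prop :=
  exists G : {mpoly K[k]}, F = (\prod_(r < k) 'X_r) * G.

(* The coefficient at \hat b_{i,c} is F(x_{i_1}, ..., x_{i_k}) x_c. *)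
Definition hatM (k : nat) (F : {mpoly K[k]}) : {mpoly K[k.+1]} :=
  mwiden F * 'X_ord_max.

(* The coefficient at \hat b_j is \sum_(c \notin j) F(x_c, x_{j_1}, ..., x_{j_k}).
   For a monomial x_c^m0 * ..., with m0 >= 1, the sum of x_c^m0 over all c not
   in j is p_m0 - \sum_r x_{j_r}^m0. *)
Definition hatD (k : nat) (F : {mpoly K[k.+1]}) : {mpoly K[k]} :=
  \sum_(m <- mpoly.msupp F) mpoly.mcoeff m F *:
    (((psum (m ord0))%:MP - \sum_(r < k) 'X_r ^+ m ord0)
       * \prod_(r < k) 'X_r ^+ m (lift ord0 r)).

Definition is_U_family (U : forall k, {linear V k -> {mpoly K[k]}}) : Prop :=
  [/\ forall k v, hatV (U k v),
      U 0%N (b [tuple]) = 1,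
      forall k v, U k.+1 (M k v) = hatM (U k v)
    & forall k v, hatD (U k.+1 v) = U k (D k v)].

(** * N colors *)

Section FiniteColors.
Variable N : nat.

Definition L : fieldType := {fraction {mpoly rat[N]}}.

(* The element c : 'I_N stands for the color c + 1 in {1, ..., N}. *)
Definition color (c : 'I_N) : nat := c.+1.

Definition x (c : 'I_N) : L := tofrac ('X_c : {mpoly rat[N]}).
Definition eN (j : nat) : L := tofrac (mesym N rat j).

Definition IN_pred (k : nat) : pred (k.-tuple 'I_N) := fun t => uniq t.
Definition IN (k : nat) : finType := {t : k.-tuple 'I_N | IN_pred t}.

(* The spaces V_k and \hat V_k, with respective bases b and \hat b. *)
Definition VN (k : nat) : lmodType L := {malg L[IN k]}.
Definition hatVN (k : nat) : lmodType L := {malg L[IN k]}.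
Definition bN (k : nat) (t : k.-tuple 'I_N) : VN k := bvec L (@IN_pred k) t.
Definition hatbN (k : nat) (t : k.-tuple 'I_N) : hatVN k := bvec L (@IN_pred k) t.

Definition MN (k : nat) : {linear VN k -> VN k.+1} :=
  lext (fun s : IN k =>
    \sum_(y : 'I_N | y \notin val s)
      A L (color y) (map color (val s)) *: bN [tuple of rcons (val s) y]).

Definition DN (k : nat) : {linear VN k.+1 -> VN k} :=
  lext (fun s : IN k.+1 =>
    (eN (color (thead (val s))) / eN (color (thead (val s))).-1)
      *: bN [tuple of behead (val s)]).

Definition hatMN (k : nat) : {linear hatVN k -> hatVN k.+1} :=
  lext (fun i : IN k =>
    \sum_(c : 'I_N | c \notin val i) x c *: hatbN [tuple of rcons (val i) c]).

Definition hatDN (k : nat) : {linear hatVN k.+1 -> hatVN k} :=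
  lext (fun i : IN k.+1 => hatbN [tuple of behead (val i)]).

(* Setting x_c = 0 for c > N in Q[e_1, e_2, ...]: e_j is sent to
   e_j(x_1, ..., x_N), which is 0 for j > N. *)
Definition specQe (f : Qe) : {mpoly rat[N]} :=
  monalg.mmap (@mpolyC N rat)
    (fun m : {cmonom nat} => \prod_(j <- finsupp m) mesym N rat j.+1 ^+ m j) f.

(* Setting x_c = 0 for c > N in a rational function in e_1, e_2, ...: defined
   for fractions n / d whose denominator is not sent to 0, the value being then
   independent of the choice of n and d. *)
Definition is_spec (f : K) (y : L) : Prop :=
  exists n d : Qe,
    [/\ specQe d != 0, f = tofrac n / tofrac d
      & y = tofrac (specQe n) / tofrac (specQe d)].

(* Arbitrary where is_spec is undefined. *)
Definition spec (f : K) : L := epsilon (inhabits 0) (is_spec f).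

(* F(x_{i_1}, ..., x_{i_k}) with x_c = 0 for c > N, where i_1, ..., i_k <= N. *)
Definition spec_coef (k : nat) (F : {mpoly K[k]}) (i : k.-tuple 'I_N) : L :=
  mpoly.mmap spec (fun r : 'I_k => x (tnth i r)) F.

Definition UN (U : forall k, {linear V k -> {mpoly K[k]}}) (k : nat) :
    {linear VN k -> hatVN k} :=
  lext (fun s : IN k =>
    \sum_(i : IN k)
      spec_coef (U k (b [tuple of map color (val s)])) (val i) *: hatbN (val i)).

End FiniteColors.

(* Main.v *)
(** Every permutation of [1..m] is obtained from one of [1..m-1] by appending m
    and then rotating; every tuple of distinct positive integers is a tail of
    such a permutation. Appending is controlled by M, dropping a head by D and
    rotating [y :: t] into [rcons t y] by both, so the two intertwining
    relations determine U, and the only denominators they introduce are the e_j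
    with j < m. Hence the coefficients of U b_s, for s within [1..N+1], survive
    setting x_c = 0 for c > N, and the relation with D descends to N colors.
    The finite M omits the color y = N+1; this is harmless because U b_s
    vanishes in N colors as soon as s contains N+1: for a permutation of
    [1..N+1] there are no N+1 distinct colors, and D propagates the vanishing
    to the tails.

    For invertibility only the hat side matters: the image of U is stable under
    [hatM] and [hatD]. By induction it contains
    [hatM b_j = \sum_c x_c b_(j,c)]. Modulo such vectors [hatD hatM] acts on
    the hat space as minus the weighted rotation [b_i |-> x_(i_1) b_(i_2..i_k,i_1)],
    whose k-th power is diagonal; its eigenvalues separate the terms of the sum,
    so every b_(j,c) is in the image. *)

From HB Require Import structures.
From Stdlib Require Import ClassicalEpsilon.
Require Import Defs.
From mathcomp Require Import all_boot all_algebra finmap.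
From mathcomp Require Import zify.
From mathcomp.multinomials Require Import monalg mpoly.

Set Implicit Arguments.
Unset Strict Implicit.
Unset Printing Implicit Defensive.

Import GRing.Theory.
Local Open Scope ring_scope.

Local Notation "{ 'mpoly' R [ n ] }" := (mpoly.mpoly n R) : type_scope.

(** * Specialization of fractions *)

Section FracSpec.
Variables (R S : idomainType) (s : {rmorphism R -> S}).
Local Notation tf := (@FracField.tofrac _).

(** The graph of the extension of [s] to the localization of [R] at the prime ideal ker [s]. For
    [s := specQe_rmorphism] it is convertible to [is_spec], so each closure property below transfers
    to [is_spec] by [exact]. *)
Definition frac_spec (f : {fraction R}) (y : {fraction S}) : Prop :=
  exists n d : R, [/\ s d != 0, f = tf n / tf d & y = tf (s n) / tf (s d)].

Local Notation sp := frac_spec.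

Let nz d : s d != 0 -> d != 0.
Proof. by apply: contra => /eqP ->; rewrite rmorph0. Qed.

Lemma frac_spec_fun f y z : sp f y -> sp f z -> y = z.
Proof.
case=> n [d [d0 -> ->]] [n' [d' [d'0 E ->]]].
have: tf n * tf d' = tf n' * tf d.
  apply/eqP; rewrite -eqr_div ?tofrac_eq0 ?nz //; exact/eqP.
rewrite -!tofracM => /eqP; rewrite tofrac_eq => /eqP /(congr1 s).
rewrite !rmorphM => {}E; apply/eqP; rewrite eqr_div ?tofrac_eq0 //.
by rewrite -!tofracM tofrac_eq; apply/eqP.
Qed.

Lemma frac_spec_tofrac n : sp (tf n) (tf (s n)).
Proof. by exists n, 1; rewrite !rmorph1 !divr1 oner_eq0. Qed.

Lemma frac_spec0 : sp 0 0.
Proof. by have := frac_spec_tofrac 0; rewrite !rmorph0. Qed.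

Lemma frac_spec1 : sp 1 1.
Proof. by have := frac_spec_tofrac 1; rewrite !rmorph1. Qed.

Lemma frac_specD f g y z : sp f y -> sp g z -> sp (f + g) (y + z).
Proof.
move=> [n [d [d0 -> ->]]] [n' [d' [d'0 -> ->]]].
exists (n * d' + n' * d), (d * d').
rewrite !rmorphD !rmorphM; split; first by rewrite mulf_neq0.
  by rewrite addf_div ?tofrac_eq0 ?nz.
by rewrite addf_div ?tofrac_eq0.
Qed.

Lemma frac_specM f g y z : sp f y -> sp g z -> sp (f * g) (y * z).
Proof.
move=> [n [d [d0 -> ->]]] [n' [d' [d'0 -> ->]]].
exists (n * n'), (d * d').
rewrite !rmorphM; split; first by rewrite mulf_neq0.
  by rewrite mulf_div.
by rewrite mulf_div.
Qed.

Lemma frac_specN f y : sp f y -> sp (- f) (- y).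
Proof.
by move=> [n [d [d0 -> ->]]]; exists (- n), d; rewrite !rmorphN !mulNr.
Qed.

(** The excluded case is a nonzero [f] with specialization 0. If both are 0, the convention that 0
    is its own inverse gives the claim. *)
Lemma frac_specV f y : (y = 0 -> f = 0) -> sp f y -> sp f^-1 y^-1.
Proof.
have [-> /(_ erefl) -> _|y0 _] := eqVneq y 0.
  by rewrite !invr0; apply: frac_spec0.
move=> [n [d [d0 -> yE]]]; exists d, n; rewrite yE !invf_div; split=> //.
by move: y0; rewrite yE mulf_eq0 negb_or tofrac_eq0 => /andP[].
Qed.

End FracSpec.

(** * Specialization of elements of [K] to N colors *)

Section Spec.
Variable N : nat.

(* The image of a monomial in the defining formula of specQe. *)
Definition specmon (m : {cmonom nat}) : {mpoly rat[N]} :=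
  \prod_(j <- finsupp m) mesym N rat j.+1 ^+ m j.

Lemma specmonEw (d : {fset nat}) (m : {cmonom nat}) : (finsupp m `<=` d)%fset ->
  specmon m = \prod_(j <- d) mesym N rat j.+1 ^+ m j.
Proof.
move=> le; rewrite /specmon (big_fset_incl _ le) // => j _.
by rewrite -cmE_eq0 => /eqP ->; rewrite expr0.
Qed.

Lemma specmon_morph : mmorphism specmon.
Proof.
split=> [m1 m2|]; last by rewrite /specmon mdom1 big_seq_fset0.
pose d := (finsupp m1 `|` finsupp m2)%fset.
rewrite (@specmonEw d m1) ?fsubsetUl // (@specmonEw d m2) ?fsubsetUr //.
rewrite (@specmonEw d) ?mdomD // -big_split /=.
by apply: eq_bigr => j _; rewrite cmM exprD.
Qed.

HB.instance Definition _ :=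
  isMultiplicative.Build {cmonom nat} {mpoly rat[N]} specmon specmon_morph.

(** [specQe] is a bare function; this is the same function with its morphism structure, to which the
    lemmas on [frac_spec] apply. *)
Definition specQe_rmorphism : {rmorphism Qe -> {mpoly rat[N]}} :=
  (monalg.mmap (@mpolyC N rat) specmon : {rmorphism {malg rat[{cmonom nat}]} -> _}).

Lemma specQe_eQ j : specQe N (eQ j) = mesym N rat j.
Proof.
rewrite eQ.unlock; case: j => [|j].
  by rewrite mesym0E; apply: (rmorph1 specQe_rmorphism).
rewrite /specQe monalg.mmapU [X in X * _]mpolyC1 mul1r mdomU big_seq_fset1 cmUU.
by rewrite expr1.
Qed.

Local Notation sp := (@is_spec N).
Local Notation tf := (@FracField.tofrac _).

Lemma is_spec_fun f y z : sp f y -> sp f z -> y = z.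
Proof. exact: (@frac_spec_fun _ _ specQe_rmorphism). Qed.

Lemma is_spec_spec f y : sp f y -> spec N f = y.
Proof.
move=> fy; apply: (is_spec_fun _ fy); rewrite /spec.
exact: (epsilon_spec (inhabits 0) (is_spec f) (ex_intro _ y fy)).
Qed.

Lemma is_spec0 : sp 0 0.
Proof. exact: (frac_spec0 specQe_rmorphism). Qed.

Lemma is_spec1 : sp 1 1.
Proof. exact: (frac_spec1 specQe_rmorphism). Qed.

Lemma is_specD f g y z : sp f y -> sp g z -> sp (f + g) (y + z).
Proof. exact: (@frac_specD _ _ specQe_rmorphism). Qed.

Lemma is_specM f g y z : sp f y -> sp g z -> sp (f * g) (y * z).
Proof. exact: (@frac_specM _ _ specQe_rmorphism). Qed.

Lemma is_specN f y : sp f y -> sp (- f) (- y).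
Proof. exact: (@frac_specN _ _ specQe_rmorphism). Qed.

Lemma is_specV f y : (y = 0 -> f = 0) -> sp f y -> sp f^-1 y^-1.
Proof. exact: (@frac_specV _ _ specQe_rmorphism). Qed.

Lemma is_spec_e j : sp (e j) (eN N j).
Proof.
have := @frac_spec_tofrac _ _ specQe_rmorphism (eQ j).
by rewrite [specQe_rmorphism _]specQe_eQ.
Qed.

Lemma is_specB f g y z : sp f y -> sp g z -> sp (f - g) (y - z).
Proof. by move=> fy gz; apply: is_specD => //; apply: is_specN. Qed.

Lemma is_specX f y n : sp f y -> sp (f ^+ n) (y ^+ n).
Proof.
by move=> fy; elim: n => [|n IH]; [apply: is_spec1 | rewrite !exprS; apply: is_specM].
Qed.

Lemma is_spec_nat n : sp n%:R n%:R.
Proof.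
by elim: n => [|n IH]; [apply: is_spec0 | rewrite !mulrSr; apply: is_specD is_spec1].
Qed.

Lemma is_spec_sum (I : Type) (r : seq I) (P : pred I) F G :
  (forall i, P i -> sp (F i) (G i)) ->
  sp (\sum_(i <- r | P i) F i) (\sum_(i <- r | P i) G i).
Proof.
by move=> H; apply: big_ind2 => //; [apply: is_spec0 | move=> ????; apply: is_specD].
Qed.

Lemma is_spec_prod (I : Type) (r : seq I) (P : pred I) F G :
  (forall i, P i -> sp (F i) (G i)) ->
  sp (\prod_(i <- r | P i) F i) (\prod_(i <- r | P i) G i).
Proof.
by move=> H; apply: big_ind2 => //; [apply: is_spec1 | move=> ????; apply: is_specM].
Qed.

Lemma eN_neq0 j : (j <= N)%N -> eN N j != 0.
Proof. by move=> le; rewrite tofrac_eq0 mesym_neq0. Qed.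

Lemma e_neq0 j : e j != 0.
Proof.
rewrite tofrac_eq0 eQ.unlock; case: j => [|j]; first exact: oner_neq0.
apply/eqP => /(congr1 (monalg.mcoeff (ucm j))).
by rewrite monalg.mcoeff0 mcoeffU1 eqxx => /eqP; rewrite oner_eq0.
Qed.

Lemma natrL_eq0 n : (n%:R == 0 :> L N) = (n == 0)%N.
Proof.
rewrite -tofrac1 -tofracMn tofrac_eq0 -mpolyC_nat mpolyC_eq0.
exact: Num.Theory.pnatr_eq0.
Qed.

Lemma natrL_inj : injective (fun n => n%:R : L N).
Proof.
move=> m n /= /eqP; wlog le : m n / (n <= m)%N => [W|].
  by case: (leqP n m) => [/W//|/ltnW /W]; rewrite eq_sym => W' /W'.
rewrite -subr_eq0 -natrB // natrL_eq0 subn_eq0 => le'.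
by apply/eqP; rewrite eqn_leq le'.
Qed.

Lemma is_spec_natB m n : sp (m%:R - n%:R) (m%:R - n%:R).
Proof. by apply: is_specB; apply: is_spec_nat. Qed.

(** An equality of naturals in [L] is one of natural numbers, hence holds in [K] too. For [m = n]
    both inverses are 0, so the factors of [A] are treated uniformly. *)
Lemma is_spec_natBV m n : sp (m%:R - n%:R)^-1 (m%:R - n%:R)^-1.
Proof.
apply: is_specV (is_spec_natB _ _) => /eqP; rewrite subr_eq0 => /eqP /natrL_inj ->.
by rewrite subrr.
Qed.

Lemma is_spec_natV n : sp n%:R^-1 n%:R^-1.
Proof. by have := is_spec_natBV n 0; rewrite !subr0. Qed.

Lemma is_spec_A y s : sp (A K y s) (A (L N) y s).
Proof.
rewrite /A; case: ifP => _.
  by apply: is_spec_prod => z _; apply: is_specM (is_spec_natV _); apply: is_spec_natB _ 1%N.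
case: ifP => _; last exact: is_spec0.
apply: is_specM.
  by apply: is_specM (is_spec_natV _); rewrite -!mulrSr; apply: is_spec_nat.
apply: is_spec_prod => z _; apply: is_specM (is_spec_natBV _ _).
by apply: is_specD is_spec1; apply: is_spec_natB.
Qed.

End Spec.

(** * Newton's identities *)

Section Newton.
Variables (I : finType) (R : comNzRingType) (x : I -> R).

Let E := \prod_c (1 + x c *: 'X) : {poly R}.

(** Leibniz rule. The filter [P] keeps products with one factor removed in the same form during the
    induction on [r]. *)
Lemma deriv_prod_linear (r : seq I) (P : pred I) : uniq r ->
  (\prod_(c <- r | P c) (1 + x c *: 'X))^`()
  = \sum_(c <- r | P c) x c *: \prod_(d <- r | P d && (d != c)) (1 + x d *: 'X).
Proof.
elim: r => [|a r IH] /=; first by rewrite !big_nil derivC.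
case/andP=> ar ur; rewrite !big_cons eqxx andbF; case: ifP => Pa.
  have -> : \prod_(d <- r | P d && (d != a)) (1 + x d *: 'X)
            = \prod_(d <- r | P d) (1 + x d *: 'X).
    rewrite big_seq_cond [RHS]big_seq_cond.
    apply: eq_bigl => d; case: (boolP (d \in r)) => //= dr.
    by case: eqP dr => [->|]; rewrite ?andbT // (negPf ar).
  rewrite derivM derivD derivC derivZ derivX add0r IH //.
  rewrite -scalerAl mul1r mulr_sumr; congr (_ + _).
  rewrite big_seq_cond [RHS]big_seq_cond; apply: eq_bigr => c /andP[cr _].
  rewrite big_cons Pa; have -> /= : a != c by apply: contraNneq ar => ->.
  by rewrite scalerAr.
rewrite IH //; apply: eq_bigr => c _; congr (_ *: _).
by rewrite big_cons Pa.
Qed.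

(** With E the product, E' is the sum of x_c E / (1 + x_c X); expanding 1 / (1 + x_c X) as a
    geometric series and comparing coefficients of X^m gives the identity. [coefEc] is this
    expansion of E / (1 + x_c X), obtained without division from the recursion for the coefficients
    of E. *)
Lemma newton m :
  (\prod_c (1 + x c *: 'X))`_m.+1 *+ m.+1
  = \sum_(i < m.+1) (-1) ^+ i * (\sum_c x c ^+ i.+1)
      * (\prod_c (1 + x c *: 'X))`_(m - i).
Proof.
have coefEc c : (\prod_(d | d != c) (1 + x d *: 'X))`_m
    = \sum_(i < m.+1) (- x c) ^+ i * E`_(m - i).
  have EE : E = (1 + x c *: 'X) * \prod_(d | d != c) (1 + x d *: 'X).
    by rewrite /E (bigD1 c).
  elim: m => [|m IH].
    rewrite big_ord1 expr0 mul1r subn0 EE mulrDl mul1r coefD -scalerAl coefZ.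
    by rewrite coefXM mulr0 addr0.
  have ES : E`_m.+1 = (\prod_(d | d != c) (1 + x d *: 'X))`_m.+1
                     + x c * (\prod_(d | d != c) (1 + x d *: 'X))`_m.
    by rewrite EE mulrDl mul1r coefD -scalerAl coefZ coefXM.
  rewrite big_ord_recl expr0 mul1r subn0 ES IH -addrA; apply/eqP.
  rewrite addrC -subr_eq subrr eq_sym; apply/eqP.
  rewrite mulr_sumr -big_split big1 //= => i _.
  by rewrite /bump /= subSS exprS !mulrA -!mulrDl subrr !mul0r.
rewrite -coef_deriv deriv_prod_linear ?index_enum_uniq // coef_sum.
have -> : \sum_c (x c *: \prod_(d | d != c) (1 + x d *: 'X))`_m
        = \sum_c \sum_(i < m.+1) (-1) ^+ i * x c ^+ i.+1 * E`_(m - i).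
  apply: eq_bigr => c _; rewrite coefZ coefEc mulr_sumr.
  by apply: eq_bigr => i _; rewrite mulrA [(- x c) ^+ i]exprNn mulrCA -exprS.
rewrite exchange_big; apply: eq_bigr => i _ /=.
by rewrite mulr_sumr mulr_suml.
Qed.

End Newton.

(** * Specialization of the power sums *)

Section PsumSpec.
Variable N : nat.

Lemma coef_prod_mesym (R : comNzRingType) j :
  (\prod_(c < N) (1 + ('X_c : {mpoly R[N]}) *: 'X))`_j = mesym N R j.
Proof.
rewrite (eq_bigr (fun c => ('X_c : {mpoly R[N]}) *: 'X + 1)); last first.
  by move=> c _; rewrite addrC.
rewrite bigA_distr coef_sum /mesym [RHS]big_mkcond; apply: eq_bigr => J _.
rewrite big_if /= big1_eq mulr1 scaler_prod prodr_const coefZ coefXn eq_sym.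
by case: eqP => _; rewrite ?mulr1 ?mulr0.
Qed.

Lemma newton_mesym m :
  mesym N rat m.+1 *+ m.+1
  = \sum_(i < m.+1) (-1) ^+ i * (\sum_(c < N) 'X_c ^+ i.+1) * mesym N rat (m - i).
Proof.
have := newton (fun c : 'I_N => 'X_c : {mpoly rat[N]}) m.
rewrite coef_prod_mesym => ->; apply: eq_bigr => i _.
by rewrite coef_prod_mesym.
Qed.

Lemma newton_eN m :
  eN N m.+1 *+ m.+1
  = \sum_(i < m.+1) (-1) ^+ i * (\sum_(c < N) x c ^+ i.+1) * eN N (m - i).
Proof.
rewrite -tofracMn newton_mesym rmorph_sum; apply: eq_bigr => i _.
rewrite !rmorphM rmorphXn rmorphN1 rmorph_sum; congr (_ * _ * _).
by apply: eq_bigr => c _; rewrite rmorphXn.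
Qed.

(** By Newton's identities the power sums of x_1, ..., x_N obey the recursion [psumS] with [eN] in
    place of [e]; strong induction then compares the two term by term. *)
Lemma is_spec_psum m : is_spec (psum m.+1) (\sum_(c < N) x c ^+ m.+1).
Proof.
elim/ltn_ind: m => m IH.
have -> : \sum_(c < N) x c ^+ m.+1
  = (-1) ^+ m * m.+1%:R * eN N m.+1
    + \sum_(i < m) (-1) ^+ i * eN N i.+1 * \sum_(c < N) x c ^+ (m - i).
  rewrite -mulrA mulr_natl newton_eN big_ord_recr /= subnn.
  have -> : eN N 0 = 1 by rewrite /eN mesym0E tofrac1.
  rewrite mulr1 mulrDr mulrA -expr2 sqrr_sign mul1r addrAC.
  (* Reversing the second sum, i to m-1-i, pairs terms of opposite sign, so only the power sum of
     degree m+1 is left. *)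
  rewrite [X in X + _ + _]mulr_sumr [X in _ + X + _](reindex_inj rev_ord_inj) /=.
  rewrite -big_split [X in X + _]big1 ?add0r //= => i _.
  rewrite subKn // subnSK // !mulrA -exprD.
  have -> : (-1) ^+ (m + i) = - (-1) ^+ (m - i.+1) :> L N.
    have -> : (m + i = m - i.+1 + (i.*2).+1)%N.
      by rewrite addnS -addSn -subSn // subSS -addnn addnA subnK // ltnW.
    by rewrite exprD exprS -mul2n exprM sqrrN !expr1n mulr1 mulrN1.
  by rewrite !mulNr [X in - X]mulrAC addNr.
rewrite psumS; apply: is_specD.
  apply: is_specM (is_spec_e _ _); apply: is_specM (is_spec_nat _ _).
  by apply: is_specX; apply: is_specN; apply: is_spec1.
apply: is_spec_sum => i _; apply: is_specM.
  by apply: is_specM (is_spec_e _ _); apply: is_specX; apply: is_specN; apply: is_spec1.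
by have := IH (m - i.+1)%N; rewrite subnSK //; apply; rewrite leq_subr.
Qed.
End PsumSpec.

(** * Specialization of polynomials *)

Section PolySpec.
Variable N : nat.

(** As [spec] is a choice function and not a morphism, [spec_coef] does not compute well. The
    algebra is done on a specialized polynomial [G], and [mspec_coef] translates back. *)
Definition mspec k (F : {mpoly K[k]}) (G : {mpoly (L N)[k]}) : Prop :=
  forall m, is_spec (mpoly.mcoeff m F) (mpoly.mcoeff m G).

Definition xs k (i : k.-tuple 'I_N) (r : 'I_k) : L N := x (tnth i r).

Section Closure.
Variable k : nat.
Implicit Types (F : {mpoly K[k]}) (G : {mpoly (L N)[k]}).

Lemma mspec0 : mspec 0 (0 : {mpoly (L N)[k]}).
Proof. by move=> m; rewrite !mpoly.mcoeff0; apply: is_spec0. Qed.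

Lemma mspecD F F' G G' : mspec F G -> mspec F' G' -> mspec (F + F') (G + G').
Proof. by move=> h h' m; rewrite !mpoly.mcoeffD; apply: is_specD. Qed.

Lemma mspecN F G : mspec F G -> mspec (- F) (- G).
Proof. by move=> h m; rewrite !mpoly.mcoeffN; apply: is_specN. Qed.

Lemma mspecZ a b F G : is_spec a b -> mspec F G -> mspec (a *: F) (b *: G).
Proof. by move=> h h' m; rewrite !mpoly.mcoeffZ; apply: is_specM. Qed.

Lemma mspec_sum (I : Type) (r : seq I) (P : pred I)
    (F : I -> {mpoly K[k]}) (G : I -> {mpoly (L N)[k]}) :
  (forall i, P i -> mspec (F i) (G i)) ->
  mspec (\sum_(i <- r | P i) F i) (\sum_(i <- r | P i) G i).
Proof.
by move=> H; apply: big_ind2 => //; [apply: mspec0 | move=> ????; apply: mspecD].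
Qed.

Lemma mspecM F F' G G' : mspec F G -> mspec F' G' -> mspec (F * F') (G * G').
Proof.
move=> h h' m; rewrite !mpoly.mcoeffM; apply: is_spec_sum => m12 _.
by apply: is_specM.
Qed.

Lemma mspecX m : mspec 'X_[m] ('X_[m] : {mpoly (L N)[k]}).
Proof. by move=> m'; rewrite !mcoeffX; apply: is_spec_nat. Qed.

Lemma mspecC a b : is_spec a b -> mspec a%:MP_[k] b%:MP.
Proof. by move=> h m; rewrite !mpoly.mcoeffC; apply: is_specM => //; apply: is_spec_nat. Qed.

Lemma mspec_exp F G n : mspec F G -> mspec (F ^+ n) (G ^+ n).
Proof.
move=> h; elim: n => [|n IH]; first exact: mspecC (is_spec1 N).
by rewrite !exprS; apply: mspecM.
Qed.

Lemma mspec_prod (I : Type) (r : seq I) (P : pred I)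
    (F : I -> {mpoly K[k]}) (G : I -> {mpoly (L N)[k]}) :
  (forall i, P i -> mspec (F i) (G i)) ->
  mspec (\prod_(i <- r | P i) F i) (\prod_(i <- r | P i) G i).
Proof.
move=> H; apply: big_ind2 => //; first exact: mspecC (is_spec1 N).
by move=> ????; apply: mspecM.
Qed.

(** The support may shrink under specialization but cannot grow, since 0 specializes only to 0.
    Hence [G] can be summed over the support of [F], as the definitions of [spec_coef] and [hatD]
    require. *)
Lemma mspec_expand F G : mspec F G ->
  G = \sum_(m <- mpoly.msupp F) mpoly.mcoeff m G *: 'X_[m].
Proof.
move=> h; rewrite {1}[G]mpolyE; apply: perm_big_supp.
apply: uniq_perm; rewrite ?filter_uniq ?msupp_uniq // => m.
rewrite !mem_filter !mcoeff_msupp; case: eqP => //= G0.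
have -> : mpoly.mcoeff m G != 0.
  by apply: contra_notN G0 => /eqP ->; rewrite scale0r.
apply/esym/eqP => F0; case: G0; have := h m; rewrite F0.
by move=> /(is_spec_fun (is_spec0 N)) <-; rewrite scale0r.
Qed.

Lemma mspec_coef F G (i : k.-tuple 'I_N) : mspec F G ->
  spec_coef F i = G.@[xs i].
Proof.
move=> h; rewrite [G in RHS](mspec_expand h) raddf_sum /spec_coef /mpoly.mmap.
apply: eq_bigr => m _; rewrite /= mevalZ mevalX (is_spec_spec (h m)).
by [].
Qed.

End Closure.

Lemma mwiden_sumE (R : comNzRingType) k (I : Type) (r : seq I) (c : I -> R)
    (m : I -> 'X_{1..k}) :
  mwiden (\sum_(i <- r) c i *: 'X_[m i]) = \sum_(i <- r) c i *: 'X_[mnmwiden (m i)].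
Proof.
rewrite (big_morph _ (@mwidenD k R) (@mwiden0 k R)).
by apply: eq_bigr => i _; rewrite mwidenZ mwidenX.
Qed.

Lemma mspec_hatM k (F : {mpoly K[k]}) G : mspec F G ->
  mspec (hatM F) (mwiden G * 'X_ord_max).
Proof.
move=> h; apply: mspecM; last exact: mspecX.
rewrite [X in mspec (mwiden X) _]mpolyE (mspec_expand h) !mwiden_sumE.
by apply: mspec_sum => m _; apply: mspecZ => //; apply: mspecX.
Qed.

Lemma meval_mwiden (R : comNzRingType) k (G : {mpoly R[k]}) v :
  (mwiden G).@[v] = G.@[fun r => v (widen_ord (leqnSn k) r)].
Proof.
rewrite [X in mwiden X]mpolyE mwiden_sumE [X in _ = X.@[_]]mpolyE !raddf_sum.
apply: eq_bigr => m _ /=; rewrite !mevalZ !mevalX big_ord_recr /=.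
rewrite mnmwiden_ordmax expr0 mulr1; congr (_ * _).
by apply: eq_bigr => r _; rewrite mnmwiden_widen.
Qed.

Lemma spec_coef_hatM k (F : {mpoly K[k]}) G (i : k.-tuple 'I_N) c :
  mspec F G -> spec_coef (hatM F) [tuple of rcons i c] = spec_coef F i * x c.
Proof.
move=> h; rewrite (mspec_coef _ (mspec_hatM h)) (mspec_coef _ h) mevalM.
rewrite mevalXU meval_mwiden /xs; congr (_ * _).
  apply: meval_eq => r; rewrite !(tnth_nth c) /= nth_rcons size_tuple.
  by rewrite ltn_ord.
by rewrite (tnth_nth c) /= nth_rcons size_tuple ltnn eqxx.
Qed.

(** Divisibility by the first indeterminate ensures that [hatD] uses [psum] only at positive
    degrees, where it is a power sum. *)
Lemma hatV_supp k (F : {mpoly K[k.+1]}) m :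
  hatV F -> m \in mpoly.msupp F -> (0 < m ord0)%N.
Proof.
case=> G ->; rewrite [G]mpolyE mulr_sumr mcoeff_msupp raddf_sum /= lt0n.
apply: contra => /eqP m0; apply/eqP; apply: big1 => m' _.
rewrite -scalerAr mpoly.mcoeffZ big_ord_recl -mulrA mulrCA.
rewrite mprodXE -!mpolyXD mcoeffX; case: eqP => [E|]; last by rewrite mulr0.
by move: m0; rewrite -E !mnmDE mnm1E eqxx => /eqP; rewrite !addn_eq0 andbF.
Qed.

Lemma meval_sum (R : comNzRingType) k (I : Type) (r : seq I) (P : pred I)
    (F : I -> {mpoly R[k]}) v :
  (\sum_(i <- r | P i) F i).@[v] = \sum_(i <- r | P i) (F i).@[v].
Proof. exact: (big_morph _ (@mevalD k R v) (@meval0 k R v)). Qed.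

Lemma meval_prod (R : comNzRingType) k (I : Type) (r : seq I) (P : pred I)
    (F : I -> {mpoly R[k]}) v :
  (\prod_(i <- r | P i) F i).@[v] = \prod_(i <- r | P i) (F i).@[v].
Proof. exact: (big_morph _ (@mevalM k R v) (@meval1 k R v)). Qed.

(** [H] is the formula of [hatD] with the true power sums of x_1, ..., x_N. At distinct colors [i],
    subtracting the powers of the x_(i_r) leaves the sum over the colors outside [i]. *)
Lemma mspec_hatD k (F : {mpoly K[k.+1]}) G : mspec F G -> hatV F ->
  exists2 H, mspec (hatD F) H & forall i : k.-tuple 'I_N, uniq i ->
    H.@[xs i] = \sum_(c | c \notin i) G.@[xs [tuple of c :: i]].
Proof.
move=> h hF; pose w c := \sum_(d < N) x d ^+ c : L N.
exists (\sum_(m <- mpoly.msupp F) mpoly.mcoeff m G *: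
    (((w (m ord0))%:MP - \sum_(r < k) 'X_r ^+ m ord0)
       * \prod_(r < k) 'X_r ^+ m (lift ord0 r))).
  rewrite /hatD big_seq [X in mspec _ X]big_seq.
  apply: mspec_sum => m mF; apply: mspecZ => //; apply: mspecM.
    apply: mspecD.
      have := hatV_supp hF mF; case: (m ord0) => // n _.
      by apply: mspecC; apply: is_spec_psum.
    by apply/mspecN/mspec_sum => r _; apply/mspec_exp/mspecX.
  by apply: mspec_prod => r _; apply/mspec_exp/mspecX.
move=> i ui; rewrite raddf_sum /=.
have GE (c : 'I_N) : G.@[xs [tuple of c :: i]]
  = \sum_(m <- mpoly.msupp F) mpoly.mcoeff m G *
      (x c ^+ m ord0 * \prod_(r < k) xs i r ^+ m (lift ord0 r)).
  rewrite [X in X.@[_]](mspec_expand h) raddf_sum; apply: eq_bigr => m _ /=.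
  rewrite mevalZ mevalX big_ord_recl {1}/xs tnth0; congr (_ * (_ * _)).
  by apply: eq_bigr => r _; rewrite /xs tnthS.
rewrite (eq_bigr _ (fun c _ => GE c)) exchange_big /=; apply: eq_bigr => m _.
rewrite mevalZ mevalM mevalB mevalC meval_sum meval_prod.
rewrite -mulr_sumr -mulr_suml; congr (_ * (_ * _)); last first.
  by apply: eq_bigr => r _; rewrite rmorphXn /= mevalXU.
under eq_bigr => r _ do rewrite rmorphXn /= mevalXU.
(* The power sum is split into colors in [i] and outside; as [i] has no repetition, the first part
   is the subtracted sum over r. *)
rewrite /w (bigID (mem i)) /= addrC.
rewrite -big_uniq //= big_tuple /xs.
by rewrite addrK.
Qed.

End PolySpec.

(** * The family U *)

Lemma lextU (R : comNzRingType) (I : choiceType) (W : lmodType R) (f : I -> W) u :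
  lext f << u >> = f u.
Proof. by rewrite /lext monalg.msuppU oner_eq0 big_seq_fset1 monalg.mcoeffU eqxx scale1r. Qed.

Lemma bvecE (R : comNzRingType) (T : choiceType) (P : pred T) (t : T) (Pt : P t) :
  bvec R P t = << Sub t Pt >>.
Proof. by rewrite /bvec insubT. Qed.

Lemma M_b k (t : k.-tuple nat) : Ik_pred t ->
  M k (b t) = \sum_(y <- 1%N :: [seq z.+1 | z <- t] | y \notin tval t)
                A K y t *: b [tuple of rcons t y].
Proof. by move=> ht; rewrite {1}/b bvecE; apply: lextU. Qed.

Lemma D_b k (t : k.-tuple nat) j : Ik_pred [tuple of j :: t] ->
  D k (b [tuple of j :: t]) = (e j / e j.-1) *: b t.
Proof.
move=> ht; rewrite {1}/b bvecE; apply: etrans (lextU _ _) _.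
rewrite /= (_ : thead _ = j); last by rewrite theadE.
by congr (_ *: b _); apply: val_inj.
Qed.

(* The y on the right are those for which A(y | s) can be nonzero. *)
Lemma sum_candidates (W : nmodType) (s ys : seq nat) (F : nat -> W) :
  uniq s -> 0%N \notin s -> uniq ys ->
  (forall y, (y \in ys) =
     (y \notin s) && ((y == 1%N) || (0 < y)%N && (y.-1 \in s))) ->
  \sum_(y <- 1%N :: [seq z.+1 | z <- s] | y \notin s) F y = \sum_(y <- ys) F y.
Proof.
move=> us s0 uys mem; rewrite -big_filter; apply: perm_big.
have memS y : (y \in [seq z.+1 | z <- s]) = (0 < y)%N && (y.-1 \in s).
  case: y => [|y] /=; last by rewrite mem_map //; apply: succn_inj.
  by apply/mapP => -[].
apply: uniq_perm => //.
  rewrite filter_uniq //= map_inj_uniq ?us; last exact: succn_inj.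
  by rewrite memS /= s0.
by move=> y; rewrite mem_filter inE memS mem.
Qed.

(** A numerator vanishes only at z = 1 if y = 1, and only at z = y otherwise; both would put y in
    [s]. Injectivity of the naturals says that the characteristic is 0. *)
Lemma A_neq0 (F : fieldType) y s : injective (fun n => n%:R : F) ->
  0%N \notin s -> y \notin s -> (y == 1%N) || (0 < y)%N && (y.-1 \in s) ->
  A F y s != 0.
Proof.
move=> inj s0 ys; rewrite /A.
have nz n : n != 0%N -> n%:R != 0 :> F.
  by apply: contraNneq => n0; apply/eqP/inj.
have nzB m n : m != n -> m%:R - n%:R != 0 :> F.
  by move=> mn; rewrite subr_eq0; apply: contraNneq mn => /inj ->.
have zs z : z \in s -> z%:R != 0 :> F.
  by move=> zs; apply: nz; apply: contraNneq s0 => <-.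
case: eqP => [y1 _|_ /= /andP[y0 yps]].
  rewrite prodf_seq_neq0; apply/allP => z zin /=.
  rewrite mulf_neq0 ?invr_eq0 ?zs //; apply: (nzB z 1%N).
  by apply: contraNneq ys => z1; rewrite y1 -z1.
rewrite yps !mulf_neq0 ?invr_eq0 ?zs //.
  by rewrite -mulrSr nz.
rewrite prodf_seq_neq0; apply/allP => z zin; apply/implyP => zy.
rewrite mulf_neq0 //; last by rewrite invr_eq0 nzB // eq_sym.
by rewrite addrAC -mulrSr prednK // nzB //; apply: contraNneq ys => ->.
Qed.

(** Tuples with the same underlying list may have lengths that are equal without being convertible,
    as for concatenations. *)
Lemma tuple_transport (T : Type) (P : forall k, k.-tuple T -> Prop) k
    (t : k.-tuple T) k' (t' : k'.-tuple T) :
  tval t = tval t' -> P k t -> P k' t'.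
Proof.
move=> E; have kk : k = k' by rewrite -(size_tuple t) E size_tuple.
by case: _ / kk t' E => t' /val_inj ->.
Qed.

(** * Existence of specializations of U b_t, and their vanishing *)

Section Family.
Variables (N : nat) (U : forall k, {linear V k -> {mpoly K[k]}}).
Hypothesis hU : is_U_family U.

(** Every coefficient of U b_t lies where setting x_c = 0 for c > N is defined, so [spec_coef] has
    its intended value on it. *)
Definition good k (t : k.-tuple nat) : Prop :=
  exists G : {mpoly (L N)[k]}, mspec (U k (b t)) G.

(** As D b_(j,t) = (e_j / e_(j-1)) b_t, the relation between U and D expresses U b_t as a multiple
    of [hatD] of U b_(j,t). For [j <= N] the scalar stays nonzero in N colors, so its inverse
    specializes. *)
Lemma good_prepend k (t : k.-tuple nat) j :
  Ik_pred [tuple of j :: t] -> (j <= N)%N -> good [tuple of j :: t] ->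
  good t /\ forall i : k.-tuple 'I_N, uniq i ->
    spec_coef (U k (b t)) i = (eN N j / eN N j.-1)^-1 *
      \sum_(c | c \notin i)
        spec_coef (U k.+1 (b [tuple of j :: t])) [tuple of c :: i].
Proof.
case: hU => hV _ _ hD ht jN [G hG].
have [H hH evH] := mspec_hatD hG (hV _ _).
have eN0 : eN N j / eN N j.-1 != 0.
  by rewrite mulf_neq0 ?invr_eq0 ?eN_neq0 // (leq_trans (leq_pred _)).
have he : is_spec (e j / e j.-1) (eN N j / eN N j.-1).
  apply: is_specM (is_spec_e _ _) _; apply: is_specV (is_spec_e _ _) => /eqP.
  by rewrite (negPf (eN_neq0 _)) // (leq_trans (leq_pred _)).
have hUt : mspec (U k (b t)) ((eN N j / eN N j.-1)^-1 *: H).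
  have -> : U k (b t) = (e j / e j.-1)^-1 *: hatD (U k.+1 (b [tuple of j :: t])).
    rewrite hD D_b // linearZ scalerA mulVf ?scale1r //.
    by rewrite mulf_neq0 ?invr_eq0 ?e_neq0.
  apply: mspecZ => //; apply: is_specV => // /eqP.
  by rewrite (negPf eN0).
split=> [|i ui]; first by exists ((eN N j / eN N j.-1)^-1 *: H).
rewrite (mspec_coef _ hUt) mevalZ evH //; congr (_ * _).
by apply: eq_bigr => c _; rewrite (mspec_coef _ hG).
Qed.

Lemma is_spec_AV y s :
  0%N \notin s -> y \notin s -> (y == 1%N) || (0 < y)%N && (y.-1 \in s) ->
  is_spec (A K y s)^-1 (A (L N) y s)^-1.
Proof.
move=> s0 ys y1; apply: is_specV (is_spec_A _ _ _) => /eqP.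
by rewrite (negPf (A_neq0 (@natrL_inj N) _ _ _)).
Qed.

Lemma natrK_inj : injective (fun n => n%:R : K).
Proof.
move=> m n mn; apply: (@natrL_inj N); apply: is_spec_fun (is_spec_nat N m) _.
by rewrite [m%:R]mn; apply: is_spec_nat.
Qed.

(** For a permutation of [1..k] the only candidate in M b_t is k+1. So M b_t is a nonzero multiple
    of one basis vector, and the relation between U and M can be solved for its image. *)
Lemma good_append k (t : k.-tuple nat) : perm_eq t (iota 1 k) ->
  good t -> good [tuple of rcons t k.+1].
Proof.
case: hU => _ _ hM _ pt [G hG].
have mt z : (z \in tval t) = (0 < z <= k)%N by rewrite (perm_mem pt) mem_iota add1n.
have ut : uniq t by rewrite (perm_uniq pt) iota_uniq.
have t0 : 0%N \notin tval t by rewrite mt.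
have kt : k.+1 \notin tval t by rewrite mt ltnn andbF.
have kA : (k.+1 == 1%N) || (0 < k.+1)%N && (k.+1.-1 \in tval t) by rewrite mt; lia.
rewrite /good.
have -> : U k.+1 (b [tuple of rcons t k.+1]) = (A K k.+1 t)^-1 *: hatM (U k (b t)).
  rewrite -hM M_b; last by rewrite /Ik_pred ut t0.
  rewrite (sum_candidates (ys := [:: k.+1]) _ ut t0) //.
    by rewrite big_seq1 linearZ scalerA mulVf ?scale1r // A_neq0 //; apply: natrK_inj.
  by move=> y; rewrite inE !mt; lia.
exists ((A (L N) k.+1 t)^-1 *: (mwiden G * 'X_ord_max)).
by apply: mspecZ (mspec_hatM hG); apply: is_spec_AV.
Qed.

(* In M b_t only the candidates y and k+2 occur; the term of k+2 is a tail of
   (y, t, k+2), which good_append controls. *)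
Lemma good_rotate k (t : k.-tuple nat) y : perm_eq (y :: t) (iota 1 k.+1) ->
  (y <= k)%N -> (k <= N)%N -> good [tuple of y :: t] -> good [tuple of rcons t y].
Proof.
case: (hU) => _ _ hM _ pt yk kN gyt.
have uyt : uniq (y :: t) by rewrite (perm_uniq pt) iota_uniq.
have mt z : (z \in tval t) = (z != y) && (0 < z <= k.+1)%N.
  have := perm_mem pt z; rewrite inE mem_iota add1n ltnS => <-.
  by case: eqP => //= ->; case/andP: uyt => /negPf.
have y0 : (0 < y)%N.
  by have := perm_mem pt y; rewrite inE eqxx mem_iota; case: y {pt yk gyt uyt mt}.
have [yt ut] : y \notin tval t /\ uniq t by case/andP: uyt.
have t0 : 0%N \notin tval t by rewrite mt andbF.
have t2 : k.+2 \notin tval t by rewrite mt ltnn !andbF.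
have yA : (y == 1%N) || (0 < y)%N && (y.-1 \in tval t) by rewrite mt; lia.
have [Gt hGt] : good t.
  have [] // := good_prepend _ (leq_trans yk kN) gyt.
  by rewrite /Ik_pred uyt inE eq_sym negb_or t0 -lt0n y0.
have [G2 hG2] : good [tuple of rcons t k.+2].
  have g2 := good_append pt gyt.
  have [] // := @good_prepend _ [tuple of rcons t k.+2] y _ (leq_trans yk kN).
    rewrite /Ik_pred /= rcons_uniq ut t2 !inE !mem_rcons !inE (negPf yt) (negPf t0).
    by lia.
  exact: tuple_transport g2.
have E : U k.+1 (b [tuple of rcons t y]) = (A K y t)^-1 *:
    (hatM (U k (b t)) - A K k.+2 t *: U k.+1 (b [tuple of rcons t k.+2])).
  have -> : hatM (U k (b t)) = A K y t *: U k.+1 (b [tuple of rcons t y])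
              + A K k.+2 t *: U k.+1 (b [tuple of rcons t k.+2]).
    rewrite -hM M_b; last by rewrite /Ik_pred ut t0.
    rewrite (sum_candidates (ys := [:: y; k.+2]) _ ut t0) /=.
    - by rewrite big_cons big_seq1 linearD; congr (_ + _); apply: linearZ.
    - by rewrite inE; lia.
    - by move=> z; rewrite !inE !mt; lia.
  rewrite addrK scalerA mulVf ?scale1r //.
  by rewrite A_neq0 //; apply: natrK_inj.
rewrite /good E.
exists ((A (L N) y t)^-1 *: (mwiden Gt * 'X_ord_max - A (L N) k.+2 t *: G2)).
apply: mspecZ; first exact: is_spec_AV.
apply: mspecD (mspec_hatM hGt) _; apply/mspecN/mspecZ => //; exact: is_spec_A.
Qed.

Let goods s := good (in_tuple s).

Let goodsP k (t : k.-tuple nat) : good t -> goods t.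
Proof. exact: tuple_transport. Qed.

Let goodsW k (t : k.-tuple nat) : goods t -> good t.
Proof. exact: tuple_transport. Qed.

(** Moves the entries of [s] to the end one at a time. The entry m+1 must not be among them, because
    [good_rotate] asks for a head at most m. *)
Lemma goods_rotate m s s' : (m <= N)%N -> perm_eq (s ++ s') (iota 1 m.+1) ->
  m.+1 \notin s -> goods (s ++ s') -> goods (s' ++ s).
Proof.
move=> mN; elim: s s' => [|y s IH] s' ps ms gs; first by rewrite cats0.
have sz : size (s ++ s') = m.
  by have := perm_size ps; rewrite size_iota /= => -[].
have ym : (y <= m)%N.
  have : y \in iota 1 m.+1 by rewrite -(perm_mem ps) inE eqxx.
  by move: ms; rewrite mem_iota inE; lia.
rewrite -cat_rcons; apply: IH.
- by rewrite -rcons_cat perm_rcons.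
- by move: ms; rewrite inE negb_or => /andP[].
rewrite -rcons_cat; subst m.
apply: (goodsP (good_rotate (t := in_tuple (s ++ s')) ps ym mN _)).
exact: tuple_transport gs.
Qed.

(** Write s = (s1, m+1, s2). By induction (s2, s1) is good; appending m+1 and rotating s2 to the end
    yields s. *)
Lemma good_perm m s : (m <= N.+1)%N -> perm_eq s (iota 1 m) -> goods s.
Proof.
elim: m s => [|m IH] s mN ps.
  have -> : s = [::] by apply: size0nil; rewrite (perm_size ps).
  apply: (@goodsP 0 [tuple]); exists 1; case: hU => _ -> _ _.
  by apply: mspecC; apply: is_spec1.
have ms : m.+1 \in s by rewrite (perm_mem ps) mem_iota; lia.
case/path.splitPr: ms ps => s1 s2 ps.
have p12 : perm_eq (s2 ++ s1) (iota 1 m).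
  rewrite -(perm_cons m.+1) (perm_trans _ (perm_trans ps _)) //.
    by rewrite perm_sym -cat_cons perm_catC.
  by rewrite -{1}[m.+1]addn1 iotaD add1n cats1 perm_rcons.
have sz : size (s2 ++ s1) = m by rewrite (perm_size p12) size_iota.
have : goods (rcons (s2 ++ s1) m.+1).
  subst m; apply: (goodsP (good_append (t := in_tuple (s2 ++ s1)) p12 _)).
  by apply: goodsW; apply: IH => //; apply: ltnW.
rewrite rcons_cat -cat_rcons; apply: (@goods_rotate m) => //.
- by rewrite -rcons_cat perm_rcons (perm_trans _ ps) // -cat_cons perm_catC.
have : uniq (s1 ++ m.+1 :: s2) by rewrite (perm_uniq ps) iota_uniq.
by rewrite cat_uniq /= => /and4P[].
Qed.

Definition good_vanish k (t : k.-tuple nat) : Prop :=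
  good t /\ (N.+1 \in tval t -> forall i : k.-tuple 'I_N, uniq i ->
               spec_coef (U k (b t)) i = 0).

(** Induction on the number n of elements of [1..m] missing from t, prepending a missing j; for n =
    0 t is a permutation. The bound N+1 is allowed only when N+1 is in t, so that a missing j is
    always at most N, as [good_prepend] requires. *)
Lemma good_vanish_bounded m n k (t : k.-tuple nat) :
  (m = N) \/ (m = N.+1 /\ N.+1 \in tval t) -> (k + n = m)%N ->
  Ik_pred t -> all (fun z => z <= m)%N t -> good_vanish t.
Proof.
move=> hm; have mN1 : (m <= N.+1)%N by case: hm => [->|[-> _]].
elim: n k t hm => [|n IH] k t hm km /andP[ut t0] tm.
  have pt : perm_eq t (iota 1 m).
    have sub : {subset t <= iota 1 m}.
      move=> z zt; rewrite mem_iota add1n ltnS (allP tm) // andbT lt0n.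
      by apply: contraNneq t0 => <-.
    apply: uniq_perm (iota_uniq _ _) _ => //.
    have [] // := uniq_min_size ut sub.
    by rewrite size_iota size_tuple -km addn0.
  split; first by apply: goodsW; apply: good_perm pt.
  (* Here t has length N+1, and there are no N+1 distinct colors. *)
  move=> Nt i ui; have := max_card (mem i); rewrite card_ord.
  rewrite (card_uniqP ui) size_tuple; move: (size_tuple t) km.
  by have := allP tm _ Nt; lia.
have [j jm jt] : exists2 j, j \in iota 1 m & j \notin tval t.
  apply/hasP; rewrite has_predC; apply/negP => /allP sub.
  have := uniq_leq_size (iota_uniq 1 m) sub.
  by rewrite size_iota size_tuple; lia.
have jN : (j <= N)%N.
  move: jm; rewrite mem_iota; case: hm => [->|[-> Nt]]; first lia.
  by have : j != N.+1 by [apply: contraNneq jt => ->]; lia.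
have htj : Ik_pred [tuple of j :: t].
  rewrite /Ik_pred /= jt ut inE negb_or t0 andbT.
  by move: jm; rewrite mem_iota; lia.
have [gj vj] : good_vanish [tuple of j :: t].
  apply: IH => //.
  - by case: hm => [->|[-> Nt]]; [left | right; rewrite inE Nt orbT].
  - by rewrite addSnnS.
  - by rewrite /= tm andbT; move: jm; rewrite mem_iota; lia.
have [gt evt] := good_prepend htj jN gj.
split=> // Nt i ui; rewrite evt // big1 ?mulr0 // => c ci.
by apply: vj; rewrite /= ?inE ?Nt ?orbT // ci.
Qed.

Lemma good_vanishT k (t : k.-tuple nat) :
  Ik_pred t -> all (fun z => z <= N.+1)%N t -> good_vanish t.
Proof.
move=> ht tN; have [ut t0] := andP ht.
have kN m : all (fun z => z <= m)%N t -> (k <= m)%N.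
  move=> tm; rewrite -(size_tuple t) -(size_iota 1 m); apply: uniq_leq_size => //.
  move=> z zt; rewrite mem_iota add1n ltnS (allP tm) // andbT lt0n.
  by apply: contraNneq t0 => <-.
have [Nt|Nt] := boolP (N.+1 \in tval t).
  by apply: (@good_vanish_bounded N.+1 (N.+1 - k)) => //; [right | rewrite subnKC ?kN].
have tN' : all (fun z => z <= N)%N t.
  apply/allP => z zt; have := allP tN z zt; rewrite leq_eqVlt ltnS.
  by case/orP => // /eqP zN; rewrite -zN zt in Nt.
by apply: (@good_vanish_bounded N (N - k)) => //; [left | rewrite subnKC ?kN].
Qed.

End Family.

(** * N colors *)

Section MalgFinite.
Variables (F : fieldType) (I : finType).
Implicit Types (v : {malg F[I]}) (f : {linear {malg F[I]} -> {malg F[I]}}).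

Lemma malg_expand v : v = \sum_i monalg.mcoeff i v *: << i >>.
Proof.
apply/malgP => j; rewrite raddf_sum (bigD1 j) //= big1 => [|i ij].
  by rewrite monalg.mcoeffZ monalg.mcoeffU eqxx mulr1 addr0.
by rewrite monalg.mcoeffZ monalg.mcoeffU (negPf ij) mulr0.
Qed.

Lemma malg_linear_ext (W : lmodType F) (f g : {linear {malg F[I]} -> W}) :
  (forall i, f << i >> = g << i >>) -> f =1 g.
Proof.
move=> fg v; rewrite [v]malg_expand !linear_sum; apply: eq_bigr => i _ /=.
by rewrite !linearZ fg.
Qed.

Lemma mcoeff_linear f j v :
  monalg.mcoeff j (f v)
  = \sum_i monalg.mcoeff i v * monalg.mcoeff j (f << i >>).
Proof.
rewrite [X in f X]malg_expand linear_sum raddf_sum; apply: eq_bigr => i _ /=.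
by rewrite linearZ monalg.mcoeffZ.
Qed.

(** Preimages of the basis vectors define a linear right inverse [g]. For square matrices a
    one-sided inverse is two-sided. Rows hold the images of basis vectors, so [mx g *m mx f]
    represents [f \o g]. *)
Lemma linear_surj_bij f : (forall w, exists v, f v = w) -> bijective f.
Proof.
move=> fs; have [g0 g0P] := fin_all_exists (fun i => fs << i >>).
pose g : {linear {malg F[I]} -> {malg F[I]}} := lext g0.
pose mx (h : {linear {malg F[I]} -> {malg F[I]}}) : 'M[F]_#|I| :=
  \matrix_(i, j) monalg.mcoeff (enum_val j) (h << enum_val i >>).
have mxM (h h' : {linear {malg F[I]} -> {malg F[I]}}) i j :
    (mx h *m mx h') i j
    = monalg.mcoeff (enum_val j) (h' (h << enum_val i >>)).
  rewrite mxE mcoeff_linear.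
  rewrite [RHS](reindex_onto enum_val enum_rank) => [|l _]; last exact: enum_rankK.
  by apply: eq_big => l; rewrite ?enum_valK ?eqxx // !mxE.
have gf i : f (g << i >>) = << i >> by rewrite /g /= lextU.
have gf1 : mx g *m mx f = 1%:M.
  apply/matrixP => i j; rewrite mxM gf monalg.mcoeffU !mxE.
  by rewrite (inj_eq enum_val_inj).
have fg1 := mulmx1C gf1.
have fgU i : g (f << i >>) = << i >>.
  apply/malgP => j; have := congr1 (fun B : 'M_#|I| => B (enum_rank i) (enum_rank j)) fg1.
  by rewrite mxM !mxE !enum_rankK monalg.mcoeffU (inj_eq enum_rank_inj).
exists g.
  exact: (malg_linear_ext (f := g \o f) (g := idfun)).
exact: (malg_linear_ext (f := f \o g) (g := idfun)).
Qed.

End MalgFinite.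

(** * The intertwining relations in N colors *)

Section FiniteColors.
Variables (N : nat) (U : forall k, {linear V k -> {mpoly K[k]}}).
Hypothesis hU : is_U_family U.
Local Notation hatb := (@hatbN N).

Lemma hatbE k (i : IN N k) : hatb (val i) = << i >>.
Proof.
by rewrite /hatbN (bvecE _ (valP i)); congr << _ >>; apply: val_inj; rewrite SubK.
Qed.

Lemma hatb_eq0 k (t : k.-tuple 'I_N) : ~~ uniq t -> hatb t = 0.
Proof. by move=> ut; rewrite /hatbN /bvec insubN. Qed.

Lemma mcoeff_hatb k (t : k.-tuple 'I_N) (i : IN N k) :
  monalg.mcoeff i (hatb t) = (val i == t)%:R.
Proof.
rewrite /hatbN /bvec; case: insubP => [u _ <-|ut].
  by rewrite monalg.mcoeffU eq_sym (inj_eq val_inj); case: (u == i).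
rewrite monalg.mcoeff0; case: eqP => // E.
by move: ut; rewrite -E (valP i).
Qed.

Lemma ulift_color k (t : k.-tuple 'I_N) : uniq t ->
  Ik_pred [tuple of map (@color N) t].
Proof.
move=> ut; rewrite /Ik_pred /= map_inj_uniq ?ut /=; last by move=> c d [] /val_inj.
by apply/mapP => -[].
Qed.

Lemma all_color n k (t : k.-tuple 'I_N) : (N <= n)%N ->
  all (fun z => z <= n)%N (map (@color N) t).
Proof. by move=> Nn; apply/allP => z /mapP[c _ ->]; apply: leq_trans (ltn_ord c) Nn. Qed.

Local Notation Uc s := (U _ (b [tuple of map (@color N) s])).

Lemma UN_b k (s : k.-tuple 'I_N) : uniq s ->
  UN N U k (bN s) = \sum_(i : IN N k) spec_coef (Uc s) (val i) *: hatb (val i).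
Proof. by move=> us; rewrite /bN bvecE; apply: lextU. Qed.

Lemma mcoeff_UN_b k (s : k.-tuple 'I_N) (j : IN N k) : uniq s ->
  monalg.mcoeff j (UN N U k (bN s)) = spec_coef (Uc s) (val j).
Proof.
move=> us; rewrite UN_b // raddf_sum (bigD1 j) //= big1 => [|i ij].
  by rewrite monalg.mcoeffZ mcoeff_hatb eqxx mulr1 addr0.
rewrite monalg.mcoeffZ mcoeff_hatb (inj_eq val_inj) [j == i]eq_sym (negPf ij).
by rewrite mulr0.
Qed.

Lemma MN_b k (s : k.-tuple 'I_N) : uniq s -> MN N k (bN s) =
  \sum_(y | y \notin s) A (L N) (color y) (map (@color N) s) *: bN [tuple of rcons s y].
Proof. by move=> us; rewrite {1}/bN bvecE; apply: lextU. Qed.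

Lemma DN_b k (s : k.-tuple 'I_N) y : uniq (y :: s) -> DN N k (bN [tuple of y :: s]) =
  (eN N (color y) / eN N (color y).-1) *: bN s.
Proof.
move=> us; rewrite {1}/bN bvecE; apply: etrans (lextU _ _) _.
rewrite /= (_ : thead _ = y); last by rewrite theadE.
by congr (_ *: bN _); apply: val_inj.
Qed.

Lemma hatMN_b k (i : k.-tuple 'I_N) : uniq i -> hatMN N k (hatb i) =
  \sum_(c | c \notin i) x c *: hatb [tuple of rcons i c].
Proof. by move=> us; rewrite {1}/hatbN bvecE; apply: lextU. Qed.

Lemma hatDN_b k (i : k.-tuple 'I_N) c : uniq (c :: i) ->
  hatDN N k (hatb [tuple of c :: i]) = hatb i.
Proof.
move=> us; rewrite {1}/hatbN bvecE; apply: etrans (lextU _ _) _.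
by congr hatbN; apply: val_inj.
Qed.

(** Linearity of [spec_coef] is available only where specializations exist, hence the conditions on
    each term. *)
Lemma spec_coef_sum k (r : seq nat) a b (F : nat -> {mpoly K[k]}) :
  (forall y, y \in r -> is_spec (a y) (b y) /\ exists G : {mpoly (L N)[k]}, mspec (F y) G) ->
  forall i : k.-tuple 'I_N, spec_coef (\sum_(y <- r) a y *: F y) i
    = \sum_(y <- r) b y * spec_coef (F y) i.
Proof.
move=> H; have [G hG evG] : exists2 G : {mpoly (L N)[k]},
    mspec (\sum_(y <- r) a y *: F y) G &
    forall i : k.-tuple 'I_N, G.@[xs i] = \sum_(y <- r) b y * spec_coef (F y) i.
  elim: r H => [|y r IH] H.
    exists 0; first by rewrite big_nil; apply: mspec0.
    by move=> i; rewrite big_nil meval0.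
  have [z zr|G hG evG] := IH; first by apply: H; rewrite inE zr orbT.
  have [hab [G' hG']] := H y (mem_head _ _).
  exists (b y *: G' + G).
    by rewrite big_cons; apply: mspecD => //; apply: mspecZ.
  by move=> i; rewrite big_cons mevalD mevalZ evG (mspec_coef _ hG').
by move=> i; rewrite (mspec_coef _ hG) evG.
Qed.

Lemma tuple_rconsP (T : Type) k (t : k.+1.-tuple T) :
  exists (i : k.-tuple T) c, t = [tuple of rcons i c].
Proof.
have sz : size (belast (thead t) (behead t)) == k.
  by rewrite size_belast size_behead size_tuple.
exists (Tuple sz), (last (thead t) (behead t)); apply: val_inj => /=.
by rewrite -lastI; case: t sz => -[].
Qed.

Lemma sum_colors (W : nmodType) (f : nat -> W) (s : seq 'I_N) :
  \sum_(y <- iota 1 N | y \notin map (@color N) s) f y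
  = \sum_(y | y \notin s) f (color y).
Proof.
have -> : iota 1 N = [seq y.+1 | y <- index_iota 0 N].
  by rewrite -[1%N]addn0 iotaDl /index_iota subn0.
rewrite big_map big_mkord.
apply: eq_bigl => c; congr (~~ _).
by rewrite (mem_map (f := @color N)) // => u v [] /val_inj.
Qed.

Lemma sum_IN (W : nmodType) k (f : k.-tuple 'I_N -> W) :
  \sum_(i : IN N k) f (val i) = \sum_(t : k.-tuple 'I_N | uniq t) f t.
Proof.
rewrite [RHS](reindex_omap (val : IN N k -> _) insub) => [|t ut].
  by apply: eq_bigl => i; rewrite valK eqxx andbT; apply/esym/(valP i).
by rewrite insubT.
Qed.

Lemma sum_IN_cons (W : nmodType) k (f : k.+1.-tuple 'I_N -> W) :
  \sum_(i : IN N k.+1) f (val i)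
  = \sum_(j : IN N k) \sum_(c | c \notin val j) f [tuple of c :: val j].
Proof.
rewrite sum_IN (sum_IN (fun j => \sum_(c | c \notin j) f [tuple of c :: j])).
rewrite pair_big_dep /=.
rewrite (reindex (fun p : k.-tuple 'I_N * 'I_N => [tuple of p.2 :: p.1])) /=.
  by apply: eq_bigl => p; rewrite andbC.
exists (fun t : k.+1.-tuple 'I_N => ([tuple of behead t], thead t)) => [[j c] _|t _] /=.
  by congr (_, _); apply: val_inj.
by rewrite [RHS]tuple_eta; apply: val_inj.
Qed.

(** Both the candidates of [M] and the colors of [MN] are compared with the sum over all y in
    [1..N+1] outside t; the two differences are zero terms. *)
Lemma spec_coef_M k (t : k.-tuple 'I_N) (i : k.+1.-tuple 'I_N) :
  uniq t -> uniq i ->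
  spec_coef (U k.+1 (M k (b [tuple of map (@color N) t]))) i
  = \sum_(y | y \notin t)
      A (L N) (color y) (map (@color N) t) * spec_coef (Uc [tuple of rcons t y]) i.
Proof.
move=> ut ui; set ct := [tuple of map (@color N) t].
have hct : Ik_pred ct by apply: ulift_color.
have [uct ct0] := andP hct.
have ctN y : y \in tval ct -> (y <= N)%N by apply: (allP (all_color t (leqnn N))).
pose cand y := (y == 1%N) || (0 < y)%N && (y.-1 \in tval ct).
(* A candidate is 1 or the successor of an entry, and the entries are at most N. *)
pose ys := [seq y <- iota 1 N.+1 | (y \notin tval ct) && cand y].
have ysP y : (y \in ys) = (y \notin tval ct) && cand y.
  rewrite mem_filter mem_iota; case: (y \notin tval ct) => //=.
  case cy: (cand y) => //=; case/orP: cy => [/eqP-> //|/andP[y0 /ctN]].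
  by lia.
pose f y := A (L N) y ct * spec_coef (U k.+1 (b [tuple of rcons ct y])) i.
have gv y : y \in iota 1 N.+1 -> y \notin tval ct -> good_vanish N U [tuple of rcons ct y].
  rewrite mem_iota => yN yt; apply: good_vanishT => //.
    rewrite /Ik_pred /= rcons_uniq yt mem_rcons inE negb_or.
    by rewrite (negPf ct0) andbT; move: uct yN => /= ->; lia.
  by rewrite /= all_rcons all_color // andbT; move: yN; lia.
rewrite M_b // (sum_candidates (ys := ys)) // ?filter_uniq ?iota_uniq //.
rewrite linear_sum
  (eq_bigr (fun y => A K y ct *: U k.+1 (b [tuple of rcons ct y]))); last first.
  by move=> y _; apply: linearZ.
rewrite (spec_coef_sum (b := fun y => A (L N) y ct)); last first.
  move=> y; rewrite mem_filter => /andP[/andP[yt _] yN].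
  by split; [apply: is_spec_A | case: (gv y yN yt)].
(* Where y is not a candidate, A(y | t) = 0. *)
transitivity (\sum_(y <- iota 1 N.+1 | y \notin tval ct) f y).
  rewrite big_filter big_mkcondr; apply: eq_bigr => y yt; case: ifP => // /negbT.
  rewrite negb_or /f /A => /andP[/negPf ->].
  rewrite negb_and => /orP[|/negPf ->]; last by rewrite mul0r.
  by case: y {yt} => // _; rewrite (negPf ct0) mul0r.
(* The term y = N+1, which [MN] does not have, is 0 by [good_vanish]. *)
rewrite -[in iota _ _](addn1 N) iotaD big_cat /= [X in _ + X]big_mkcond big_seq1.
rewrite [X in _ + X](_ : _ = 0) ?addr0; last first.
  rewrite add1n; case: ifP => // Nt.
  have [|_ v0] := gv N.+1 _ Nt; first by rewrite mem_iota; lia.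
  by rewrite /f v0 ?mulr0 //= mem_rcons mem_head.
rewrite sum_colors; apply: eq_bigr => y _; congr (_ * spec_coef (U _ (b _)) _).
by apply: val_inj; rewrite /= map_rcons.
Qed.

Lemma UN_MN k v : UN N U k.+1 (MN N k v) = hatMN N k (UN N U k v).
Proof.
move: v; apply: (malg_linear_ext (f := UN N U k.+1 \o MN N k)
                                 (g := hatMN N k \o UN N U k)) => s /=.
have us := valP s; set t := val s in us.
have -> : << s >> = bN t by rewrite /bN (bvecE _ us); congr << _ >>; apply: val_inj.
apply/malgP => j; have [i [c ji]] := tuple_rconsP (val j).
have uj := valP j; have : uniq (rcons i c) by move: uj; rewrite ji.
rewrite rcons_uniq => /andP[ci ui].
(* Both sides have the coefficient of [hatM] (U b_t) at j = (i, c). On the right only the term of i,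
   extended by the color c, contributes. *)
transitivity (spec_coef (hatM (Uc t)) (val j)).
  case: hU => _ _ <- _; rewrite spec_coef_M // MN_b // !linear_sum raddf_sum.
  apply: eq_bigr => y yt /=; rewrite linearZ monalg.mcoeffZ mcoeff_UN_b //.
  by rewrite /= rcons_uniq yt.
have [[G hG] _] := good_vanishT hU (ulift_color us) (all_color t (leqnSn N)).
rewrite ji (spec_coef_hatM _ _ hG) UN_b // linear_sum raddf_sum /=.
rewrite (bigD1 (Sub i ui : IN N k)) //= big1 => [|i' i'i].
  rewrite addr0 linearZ monalg.mcoeffZ hatMN_b // raddf_sum (bigD1 c) //=.
  rewrite big1 ?addr0 => [|c' /andP[_ c'c]].
    by rewrite monalg.mcoeffZ mcoeff_hatb ji eqxx mulr1.
  rewrite monalg.mcoeffZ mcoeff_hatb ji -val_eqE /= eqseq_rcons eqxx [c == c']eq_sym.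
  by rewrite (negPf c'c) mulr0.
rewrite linearZ monalg.mcoeffZ (hatMN_b (valP i')) raddf_sum big1 ?mulr0 // => c' _.
rewrite /= monalg.mcoeffZ mcoeff_hatb ji -val_eqE /= eqseq_rcons.
by rewrite [_ == _ :> seq _]eq_sym [_ == _ :> seq _](negPf i'i) mulr0.
Qed.

Lemma UN_DN k v : hatDN N k (UN N U k.+1 v) = UN N U k (DN N k v).
Proof.
move: v; apply: (malg_linear_ext (f := hatDN N k \o UN N U k.+1)
                                 (g := UN N U k \o DN N k)) => s /=.
have [y [t st]] : exists y (t : k.-tuple 'I_N), val s = [tuple of y :: t].
  by exists (thead (val s)), [tuple of behead (val s)]; apply: tuple_eta.
have us : uniq (y :: t) by have := valP s; rewrite st.
have {s st}-> : << s >> = bN [tuple of y :: t].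
  by rewrite /bN (bvecE _ (us : IN_pred [tuple of y :: t])); congr << _ >>; apply: val_inj.
have /andP[yt ut] := us.
apply: etrans (esym (congr1 (UN N U k) (DN_b us))).
set a := _ / _.
have -> : UN N U k (a *: bN t) = a *: UN N U k (bN t) by apply: linearZ.
apply/malgP => j.
rewrite [RHS]monalg.mcoeffZ (mcoeff_UN_b _ ut).
have cN : (color y <= N)%N by apply: ltn_ord.
have hyt := ulift_color us.
have E : [tuple of map (@color N) [tuple of y :: t]]
         = [tuple of color y :: [tuple of map (@color N) t]] by apply: val_inj.
have [gyt _] := good_vanishT hU hyt (all_color _ (leqnSn N)).
rewrite E in hyt gyt.
(* The coefficient of U b_t at j becomes a sum over c of coefficients at (c, j), with a scalar that
   cancels the one from [DN]; these (c, j) are the tuples that [hatDN] sends to j. *)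
have [_ ->] := good_prepend hU hyt cN gyt; last exact: (valP j).
rewrite mulrA mulfV ?mul1r; last first.
  by rewrite mulf_neq0 ?invr_eq0 ?eN_neq0 // (leq_trans (leq_pred _)).
rewrite UN_b // E linear_sum raddf_sum /=.
pose f (i : k.+1.-tuple 'I_N) := monalg.mcoeff j (hatDN N k
  (spec_coef (U k.+1 (b [tuple of color y :: [tuple of map (@color N) t]])) i *: hatb i)).
rewrite (sum_IN_cons f) (bigD1 j) //= [X in _ + X]big1 => [|j' j'j].
  rewrite addr0; apply: eq_bigr => c cj; rewrite /f linearZ monalg.mcoeffZ hatDN_b.
    by rewrite mcoeff_hatb eqxx mulr1.
  by rewrite /= cj; apply: (valP j).
apply: big1 => c cj; rewrite /f linearZ monalg.mcoeffZ hatDN_b.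
  by rewrite mcoeff_hatb (inj_eq val_inj) [j == j']eq_sym (negPf j'j) mulr0.
by rewrite /= cj; apply: (valP j').
Qed.

End FiniteColors.

(** * Surjectivity *)

Lemma lext_rec (R : comNzRingType) (I : choiceType) (W : lmodType R) (f : I -> W)
    (P : W -> Prop) v :
  P 0 -> (forall a i u, P u -> P (a *: f i + u)) -> P (lext f v).
Proof. by move=> P0 PD; rewrite /lext; elim/big_rec: _ => // i u _; apply: PD. Qed.

(** Applying T - l(a) to the sum kills v(a) and rescales every other v(c) by the nonzero l(c) -
    l(a), so induction on [r] yields those v(c). Subtracting them from the sum leaves v(a). *)
Lemma eigen_split (F : fieldType) (Vs : lmodType F) (W : Vs -> Prop)
    (T : {linear Vs -> Vs}) (J : eqType) (r : seq J) (l : J -> F) (v : J -> Vs) :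
  (forall a u w, W u -> W w -> W (a *: u + w)) ->
  (forall w, W w -> W (T w)) ->
  uniq r -> {in r &, injective l} ->
  (forall c, c \in r -> T (v c) = l c *: v c) ->
  W 0 -> W (\sum_(c <- r) v c) -> forall c, c \in r -> W (v c).
Proof.
move=> WD WT ur linj Tv W0; elim: r v ur linj Tv => // a r IH v /andP[ar ur] linj Tv Ws.
have WZ c w : W w -> W (c *: w) by move=> Ww; rewrite -[_ *: w]addr0; apply: WD.
have TZ : W (\sum_(c <- r) (l c - l a) *: v c).
  have -> : \sum_(c <- r) (l c - l a) *: v c
    = (- l a) *: (\sum_(c <- a :: r) v c) + T (\sum_(c <- a :: r) v c).
    rewrite [T _]linear_sum scaler_sumr -big_split big_cons /=.
    rewrite Tv ?mem_head // -scalerDl addNr scale0r add0r.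
    rewrite big_seq [RHS]big_seq; apply: eq_bigr => c cr /=.
    by rewrite Tv ?inE ?cr ?orbT // -scalerDl addrC.
  by apply: WD => //; apply: WT.
have Wr c : c \in r -> W (v c).
  move=> cr; have ac : l c - l a != 0.
    rewrite subr_eq0; apply: contraNneq ar => /linj <- //.
      by rewrite inE cr orbT.
    exact: mem_head.
  rewrite -[v c]scale1r -(mulVf ac) -scalerA; apply: WZ.
  apply: (IH (fun c => (l c - l a) *: v c)) => // [d e dr er|d dr].
    by apply: linj; rewrite inE ?dr ?er orbT.
  by rewrite linearZ /= Tv ?inE ?dr ?orbT // !scalerA mulrC.
move=> c; rewrite inE => /predU1P[->|]; last exact: Wr.
have -> : v a = (-1) *: (\sum_(c <- r) v c) + \sum_(c <- a :: r) v c.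
  by rewrite big_cons scaleN1r addrC addrK.
apply: (WD) => //; rewrite big_seq; elim/big_rec: _ => // d w dr Ww.
by rewrite -[v d]scale1r; apply: WD => //; apply: Wr.
Qed.

Section Surjectivity.
Variables (N : nat) (U : forall k, {linear V k -> {mpoly K[k]}}).
Hypothesis hU : is_U_family U.
Local Notation hatb := (@hatbN N).

Lemma x_inj : injective (@x N).
Proof.
move=> c d /eqP; rewrite tofrac_eq => /eqP/(congr1 (mpoly.mcoeff U_(c))).
by rewrite !mcoeffXU eqxx; case: eqP => // _ /eqP; rewrite oner_eq0.
Qed.

Lemma x_neq0 c : @x N c != 0.
Proof.
rewrite tofrac_eq0; apply/eqP => /(congr1 (mpoly.mcoeff U_(c))).
by rewrite mcoeffXU eqxx mpoly.mcoeff0 => /eqP; rewrite oner_eq0.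
Qed.

Definition rotN k : {linear hatVN N k.+1 -> hatVN N k.+1} :=
  lext (fun i : IN N k.+1 =>
    x (thead (val i)) *: hatb [tuple of rot 1 (val i)]).

Lemma rotN_b k (i : k.+1.-tuple 'I_N) : uniq i ->
  rotN k (hatb i) = x (thead i) *: hatb [tuple of rot 1 i].
Proof. by move=> ui; rewrite {1}/hatbN bvecE; apply: lextU. Qed.

Fixpoint rotN_pow k n : {linear hatVN N k.+1 -> hatVN N k.+1} :=
  if n is m.+1 then rotN k \o rotN_pow k m else idfun.

(** The first n entries come to the head in turn and leave their weights. For n = k+1 the rotation
    is the identity and the weight is the product over all of i. *)
Lemma rotN_pow_b k (i : k.+1.-tuple 'I_N) n : uniq i -> (n <= k.+1)%N ->
  rotN_pow k n (hatb i) = (\prod_(c <- take n i) x c) *: hatb [tuple of rot n i].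
Proof.
move=> ui; elim: n => [_|n IH nk] /=.
  rewrite take0 big_nil scale1r; congr (hatb _); apply: val_inj => /=.
  by rewrite rot0.
have E : thead [tuple of rot n i] = tnth i (Ordinal nk).
  rewrite /thead !(tnth_nth (thead i)) /= /rot nth_cat size_drop size_tuple.
  by rewrite subn_gt0 nk nth_drop addn0.
have prodE : \prod_(c <- take n.+1 i) x c
    = (\prod_(c <- take n i) x c) * x (tnth i (Ordinal nk)).
  rewrite (take_nth (thead i)) ?size_tuple // -cats1 big_cat big_seq1.
  by rewrite (tnth_nth (thead i)).
rewrite IH ?(ltnW nk) // linearZ_LR.
rewrite (rotN_b (i := [tuple of rot n i])); last by rewrite /= rot_uniq.
apply: etrans (scalerA _ _ _) _; rewrite prodE E; congr (_ *: hatb _).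
by apply: val_inj; rewrite /= -rotS ?size_tuple.
Qed.

(** [hatD] after [hatM] turns b_(c,t) into the sum of x_d b_(t,d) over d outside (c, t), which is
    [hatM] b_t without its term d = c. That missing term is the weighted rotation. *)
Lemma rotN_cons k (t : k.-tuple 'I_N) c : uniq (c :: t) ->
  rotN k (hatb [tuple of c :: t])
  = (-1) *: hatDN N k.+1 (hatMN N k.+1 (hatb [tuple of c :: t])) + hatMN N k (hatb t).
Proof.
move=> us; have /andP[ct ut] := us.
have R1 : rotN k (hatb [tuple of c :: t]) = x c *: hatb [tuple of rcons t c].
  apply: etrans (rotN_b us) _; congr (x _ *: hatb _).
  by apply: val_inj; rewrite /= rot1_cons.
have R2 : hatDN N k.+1 (hatMN N k.+1 (hatb [tuple of c :: t]))
    = \sum_(d | d \notin c :: t) x d *: hatb [tuple of rcons t d].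
  apply: etrans (congr1 _ (hatMN_b us)) _.
  rewrite linear_sum; apply: eq_bigr => d; rewrite inE negb_or => /andP[dc dt].
  rewrite linearZ_LR; congr (_ *: _).
  have udt : uniq (c :: [tuple of rcons t d]).
    by rewrite /= mem_rcons inE negb_or [c == d]eq_sym dc ct rcons_uniq dt.
  by apply: etrans (hatDN_b udt); congr (hatDN N _ (hatb _)); apply: val_inj.
rewrite R1 R2 (hatMN_b ut) [X in _ = _ + X](bigD1 c) //=.
rewrite addrCA scaleN1r.
rewrite (eq_bigl (fun d => (d \notin t) && (d != c))); last first.
  by move=> d; rewrite inE negb_or andbC.
by rewrite addNr addr0.
Qed.

Lemma rotNE k w : rotN k w = (-1) *: hatDN N k.+1 (hatMN N k.+1 w)
  + lext (fun i : IN N k.+1 => hatMN N k (hatb [tuple of behead (val i)])) w.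
Proof.
set f := fun i : IN N k.+1 => _.
move: w; apply: (malg_linear_ext (g := ((-1) \*: (hatDN N k.+1 \o hatMN N k.+1))
                                         \+ lext f)) => s.
have [c [t st]] : exists c (t : k.-tuple 'I_N), val s = [tuple of c :: t].
  by exists (thead (val s)), [tuple of behead (val s)]; apply: tuple_eta.
have us : uniq (c :: t) by have := valP s; rewrite st.
have := rotN_cons us; rewrite -st hatbE => E; apply: etrans E _.
congr (_ + _); apply: etrans _ (esym (lextU f s)).
by congr (hatMN N k (hatb _)); apply: val_inj; rewrite /= st.
Qed.

Lemma UN_surj_b k (i : k.-tuple 'I_N) : exists v, UN N U k v = hatb i.
Proof.
elim: k i => [|k IH] i.
  exists (bN [tuple]); apply/malgP => j; rewrite mcoeff_UN_b // mcoeff_hatb.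
  have -> : val j = i by rewrite [LHS]tuple0 [RHS]tuple0.
  rewrite [i == i]eqxx.
  have -> : [tuple of map (@color N) [tuple]] = [tuple] by apply: val_inj.
  case: hU => _ -> _ _; rewrite (mspec_coef (G := 1)) ?meval1 //.
  exact: mspecC (is_spec1 N).
have [ui|ui] := boolP (uniq i); last by exists 0; rewrite linear0 hatb_eq0.
pose W w := exists v, UN N U k.+1 v = w.
have W0 : W 0 by exists 0; rewrite linear0.
have WD a u w : W u -> W w -> W (a *: u + w).
  by move=> [u' <-] [w' <-]; exists (a *: u' + w'); rewrite linearP.
(* By induction b_j is in the image in degree k, and [UN_MN] carries this to degree k+1. *)
have Wf (j : k.-tuple 'I_N) : W (hatMN N k (hatb j)).
  by have [v vE] := IH j; exists (MN N k v); rewrite -vE; apply: UN_MN.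
have WT w : W w -> W (hatDN N k.+1 (hatMN N k.+1 w)).
  move=> [v <-]; exists (DN N k.+1 (MN N k.+1 v)).
  exact: etrans (esym (UN_DN hU _)) (congr1 (hatDN N k.+1) (UN_MN hU v)).
pose f : {linear hatVN N k.+1 -> hatVN N k.+1} :=
  lext (fun i : IN N k.+1 => hatMN N k (hatb [tuple of behead (val i)])).
have RE w : rotN k w = (-1) *: hatDN N k.+1 (hatMN N k.+1 w) + f w.
  exact: rotNE.
(* The correction [f w] is a combination of vectors [hatM] b_j, which are in the image by [Wf]. *)
have WR w : W w -> W (rotN k w).
  move=> Ww; rewrite RE; apply: (WD); first exact: WT.
  by apply: lext_rec => // a i' u Wu; apply: WD => //; apply: Wf.
have WRn n w : W w -> W (rotN_pow k n w).
  by move=> Ww; elim: n => //= n; apply: WR.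
have [j [c ji]] := tuple_rconsP i.
have [cj uj] : c \notin j /\ uniq j.
  by move: ui; rewrite ji rcons_uniq => /andP[].
(* The eigenvalue at (j, c) is x_c times the product over j, which is nonzero and common to all
   c. *)
have hij : {in [seq c <- index_enum 'I_N | c \notin j] &, injective
    (fun c => \prod_(d <- rcons j c) x d)}.
  move=> d d' _ _; rewrite -!cats1 !big_cat !big_seq1 /= => /mulfI E.
  by apply: x_inj; apply: E; rewrite prodf_seq_neq0; apply/allP => z _; apply: x_neq0.
have Wc : W (x c *: hatb [tuple of rcons j c]).
  apply: (eigen_split (T := rotN_pow k k.+1) WD (WRn k.+1) _ hij _ W0
            (v := fun c => x c *: hatb [tuple of rcons j c])) => //.
  - by rewrite filter_uniq ?index_enum_uniq.
  - move=> d; rewrite mem_filter => /andP[dj _].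
    have ud : uniq (rcons j d) by rewrite rcons_uniq dj.
    have := rotN_pow_b (i := [tuple of rcons j d]) ud (leqnn k.+1).
    have -> : [tuple of rot k.+1 [tuple of rcons j d]] = [tuple of rcons j d].
      by apply: val_inj; rewrite /= rot_oversize // size_rcons size_tuple.
    rewrite take_oversize => [E|]; last by rewrite size_rcons size_tuple.
    apply: etrans (linearZ_LR _ _ _) _; apply: etrans (congr1 _ E) _.
    apply: etrans (scalerA _ _ _) (etrans _ (esym (scalerA _ _ _))).
    exact: (congr1 (fun a : L N => a *: hatb [tuple of rcons j d]) (mulrC _ _)).
  - by rewrite big_filter -(hatMN_b uj); apply: Wf.
  - by rewrite mem_filter cj mem_index_enum.
(* Dividing by x_c, which is nonzero, isolates b_(j,c). *)
rewrite ji -[hatb _]scale1r -(mulVf (x_neq0 c)) -scalerA -[_ *: _]addr0.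
exact: WD.
Qed.

Lemma UN_bijective k : bijective (UN N U k).
Proof.
apply: linear_surj_bij => w; rewrite [w]malg_expand.
elim/big_rec: _ => [|i u _ [v <-]]; first by exists 0; rewrite linear0.
have [v' v'E] := UN_surj_b (val i).
exists (monalg.mcoeff i w *: v' + v).
by rewrite linearP v'E hatbE.
Qed.

End Surjectivity.

Theorem proposition20 (N : nat)
    (U : forall k : nat, {linear V k -> mpoly.mpoly k K})
    (hU : is_U_family U) :
  (forall k : nat, (k <= N)%N -> bijective (UN N U k)) /\
  (forall k : nat, (k < N)%N ->
     (forall v : VN N k, UN N U k.+1 (MN N k v) = hatMN N k (UN N U k v)) /\
     (forall v : VN N k.+1, hatDN N k (UN N U k.+1 v) = UN N U k (DN N k v))).
Proof.
split=> [k _|k _]; first exact: UN_bijective.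
by split=> v; [apply: UN_MN | apply: UN_DN].
Qed.
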